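(* Let $\mathbf X$ be a finite set, $\mathcal H$ a finite-dimensional complex Hilbert space and $\mathcal W\subset CQ(\mathbf X,\mathcal H)$ an arbitrary (possibly infinite) set of cq-channels. Then the weak capacity of the compound cq-channel $\mathcal W$ for message transmission under the average error criterion satisfies $$\overline C_C(\mathcal W)=\max_{p\in\mathfrak P(\mathbf X)}\ \inf_{W\in\mathcal W}\chi(p,W).$$
   Context: $CQ(\mathbf X,\mathcal H)$ is the set of maps $W:\mathbf X\to\mathcal S(\mathcal H)$ (density operators on $\mathcal H$); $\mathfrak P(\mathbf X)$ is the set of probability distributions on $\mathbf X$. For $x^l=(x_1,\dots,x_l)\in\mathbf X^l$, $W^{\otimes l}(x^l):=W(x_1)\otimes\cdots\otimes W(x_l)$. Logarithms are base 2. The Holevo information is $\chi(p,W):=S(\sum_x p(x)W(x))-\sum_x p(x)S(W(x))$ with $S(\rho)=-\mathrm{tr}(\rho\log\rho)$. The compound cq-channel $\mathcal W=\{W_t\}_{t\in T}$ is the family $\{W_t^{\otimes l}\}_{l\in\mathbb N,t\in T}$. An $(l,M_l)$-code is a family $(u_m^l,D_m^l)_{m=1}^{M_l}$ with $u_m^l\in\mathbf X^l$, $D_m^l\ge 0$ operators on $\mathcal H^{\otimes l}$ with $\sum_m D_m^l\le \mathbf 1$. A number $R\ge0$ is $\lambda$-achievable (average error) if there is a sequence of $(l,M_l)$-codes with $\liminf_{l}\frac1l\log M_l\ge R$ and $\limsup_{l}\sup_{t\in T}\frac1{M_l}\sum_{m=1}^{M_l}\mathrm{tr}(W_t^{\otimes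 l}(u_m^l)(\mathbf 1-D_m^l))\le\lambda$. $\overline C_C(\mathcal W,\lambda)$ is the supremum of $\lambda$-achievable rates and $\overline C_C(\mathcal W):=\overline C_C(\mathcal W,0)$. *)

(* Defs.v *)
From HB Require Import structures.
From mathcomp Require Import all_boot all_order all_algebra.
From mathcomp Require Import all_classical all_reals all_analysis.
From mathcomp Require Import complex mxtens.
Set Implicit Arguments. Unset Strict Implicit. Unset Printing Implicit Defensive.
Import Order.TTheory GRing.Theory Num.Theory.
Local Open Scope ring_scope.
Local Open Scope classical_set_scope.

Section QuantumInfo.
Variable R : realType.
Local Notation C := R[i].

Definition adjmx m n (A : 'M[C]_(m, n)) : 'M[C]_(n, m) :=
  (map_mx (fun z : C => conjc z) A)^T.

(* positive semidefinite operator: <v, A v> >= 0 for all v (implies Hermitian) *)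
Definition psdmx n (A : 'M[C]_n) : Prop :=
  forall v : 'cV[C]_n, 0 <= (adjmx v *m A *m v) ord0 ord0.

Definition lemx n (A B : 'M[C]_n) : Prop := psdmx (B - A).

Definition density n (A : 'M[C]_n) : Prop := psdmx A /\ \tr A = 1.

Definition cq_channel (X : finType) n (W : X -> 'M[C]_n) : Prop :=
  forall x, density (W x).

Definition is_distr (X : finType) (p : X -> R) : Prop :=
  (forall x, 0 <= p x) /\ \sum_x p x = 1.

Definition log2 (x : R) : R := ln x / ln 2.

Definition xlog2x (x : R) : R := if x == 0 then 0 else x * log2 x.

Definition spectrum n (A : 'M[C]_n) : seq C :=
  xget [::] [set s : seq C | char_poly A = \prod_(z <- s) ('X - z%:P)].

(* von Neumann entropy S(rho) = - tr (rho log rho) = - sum_i lambda_i log lambda_i *)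
Definition vN_entropy n (rho : 'M[C]_n) : R :=
  - \sum_(z <- spectrum rho) xlog2x (complex.Re z).

Definition holevo (X : finType) n (p : X -> R) (W : X -> 'M[C]_n) : R :=
  vN_entropy (\sum_x (real_complex R (p x)) *: W x) - \sum_x p x * vN_entropy (W x).

Fixpoint tenspow_seq (X : Type) n (W : X -> 'M[C]_n) (xs : seq X)
  : 'M[C]_(n ^ size xs) :=
  match xs return 'M[C]_(n ^ size xs) with
  | [::] => castmx (esym (expn0 n), esym (expn0 n)) (1%:M : 'M[C]_1)
  | x :: xs' => castmx (esym (expnS n (size xs')), esym (expnS n (size xs')))
                  (W x *t tenspow_seq W xs')
  end.

Definition tenspow (X : Type) n l (W : X -> 'M[C]_n) (u : l.-tuple X)
  : 'M[C]_(n ^ l) :=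
  castmx (congr1 (expn n) (size_tuple u), congr1 (expn n) (size_tuple u))
    (tenspow_seq W u).

Definition is_code (X : Type) n l M (u : 'I_M -> l.-tuple X)
  (D : 'I_M -> 'M[C]_(n ^ l)) : Prop :=
  (forall m, psdmx (D m)) /\ lemx (\sum_m D m) 1%:M.

Definition avg_err (X : Type) n l M (W : X -> 'M[C]_n) (u : 'I_M -> l.-tuple X)
  (D : 'I_M -> 'M[C]_(n ^ l)) : R :=
  (M%:R)^-1 * \sum_(m < M) complex.Re (\tr (tenspow W (u m) *m (1%:M - D m))).

Definition achievable (X : Type) n (Wset : set (X -> 'M[C]_n)) (lam r : R) : Prop :=
  0 <= r /\
  exists (M : nat -> nat)
         (u : forall l, 'I_(M l) -> l.-tuple X)
         (D : forall l, 'I_(M l) -> 'M[C]_(n ^ l)),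
    (forall l, (0 < M l)%N) /\
    (forall l, is_code (u l) (D l)) /\
    (r%:E <= limn_einf (fun l => ((l%:R)^-1 * log2 (M l)%:R)%:E))%E /\
    (limn_esup (fun l => ereal_sup [set (avg_err W (u l) (D l))%:E | W in Wset])
       <= lam%:E)%E.

Definition cap_avg (X : Type) n (Wset : set (X -> 'M[C]_n)) (lam : R) : \bar R :=
  ereal_sup [set r%:E | r in [set r | achievable Wset lam r]].

Definition inf_holevo (X : finType) n (Wset : set (X -> 'M[C]_n)) (p : X -> R)
  : \bar R := ereal_inf [set (holevo p W)%:E | W in Wset].

End QuantumInfo.

(* Main.v *)
Require Import Defs.
From HB Require Import structures.
From mathcomp Require Import all_boot all_order all_algebra.
From mathcomp Require Import all_classical all_reals all_analysis.
From mathcomp Require Import complex mxtens.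
From mathcomp Require Import finmap ring lra.
Import Order.TTheory GRing.Theory Num.Theory.
Local Open Scope ring_scope.
Local Open Scope classical_set_scope.
Set Implicit Arguments. Unset Strict Implicit. Unset Printing Implicit Defensive.

(* Direct part. Cover the channels by finitely many W_t up to eta in operator order and smooth
   them to W'_t = (W_t + eta)/(1 + n eta), so that each channel satisfies W <= (1 + n eta) W'_t
   and its errors exceed those of W'_t by at most the factor (1 + n eta)^l. With sigma_t the
   output of W'_t under p, let tau be the sum of all sigma_t^l. The test for t is
   Pi_t P_{t,x} Pi_t, where Pi_t keeps the eigenvalues of tau below about
   exp(-l S(sigma_t)) and P_{t,x} the eigenvalues of W'_t(x) above about
   exp(-l sum_x p(x) S(W'_t(x))): its weight in tau is about exp(-l chi(p, W'_t)), and Pi_t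
   loses little because its complement has rank too small to carry mass of sigma_t^l. The tests
   for the different t are merged into one by cutting the spectrum of their sum, and a random
   codebook is decoded by the square-root measurement (Hayashi-Nagaoka). The error exponent
   of Chernoff's bound depends only on delta and n, so that eta can be chosen after it.

   Converse. The Nussbaum-Szkola pairing of the eigenbases of two states bounds the error of
   any test from below by a classical one; compared with the state (W(pbar) + eta)^l, where
   pbar is the empirical distribution of the whole codebook, Markov's inequality bounds the
   rate of a code by chi(pbar, W). As pbar does not depend on W, a near-minimizer W for pbar
   may be inserted. *)

(** * Positive semidefinite matrices *)

(** A net for an infinite family is usually refined as l grows. Here one net serves all l:
    domination in operator order costs only the factor (1 + n eta)^l, which half of a fixed exponent
    absorbs, provided the exponent does not deteriorate as eta shrinks. As smoothed states may have
    eigenvalues of order eta, the moment bounds must not involve the least eigenvalue; they rest on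
    the boundedness of sqrt(a) (ln a)^2 on (0, 1]. The outputs of different channels need not
    commute, and a codeword sent through one channel may pass the test made for another. So each
    test needs small weight in all the sigma_s^l at once, which is why the cut is made on their sum.
    In the converse the eigenbasis pairing costs a factor 2 on the error probability, harmless
    because the error vanishes. That a maximizing p exists is shown without continuity of the
    entropy: chi(p, W) has affine upper bounds in p that are nearly tight at a prescribed point, and
    upper semicontinuity passes to the infimum over W. *)

Section Adjoint.
Variable R : realType.
Local Notation C := R[i].
Local Notation adj := (@adjmx R _ _).
Local Notation "x %:C" := (real_complex R x) : ring_scope.

Lemma adjmxE m n (A : 'M[C]_(m, n)) i j : adj A i j = conjc (A j i).
Proof. by rewrite !mxE. Qed.

Lemma adjmxK m n : cancel (@adjmx R m n) (@adjmx R n m).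
Proof. by move=> A; apply/matrixP=> i j; rewrite !mxE conjcK. Qed.

Lemma adjmxM m n p (A : 'M[C]_(m, n)) (B : 'M[C]_(n, p)) :
  adj (A *m B) = adj B *m adj A.
Proof. by rewrite /adjmx map_mxM trmx_mul. Qed.

Lemma adjmxD m n (A B : 'M[C]_(m, n)) : adj (A + B) = adj A + adj B.
Proof. by rewrite /adjmx map_mxD linearD. Qed.

Lemma adjmxB m n (A B : 'M[C]_(m, n)) : adj (A - B) = adj A - adj B.
Proof. by rewrite /adjmx map_mxB linearB. Qed.

Lemma adjmxZ m n (a : R) (A : 'M[C]_(m, n)) : adj (a%:C *: A) = a%:C *: adj A.
Proof. by apply/matrixP=> i j; rewrite !mxE rmorphM /= oppr0. Qed.

Lemma adjmx1 n : adj (1%:M : 'M[C]_n) = 1%:M.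
Proof. by rewrite /adjmx map_scalar_mx rmorph1 tr_scalar_mx. Qed.

End Adjoint.
Arguments adjmxK {R m n}.

Section PSD.
Variable R : realType.
Local Notation C := R[i].
Local Notation adj := (@adjmx R _ _).
Local Notation "x %:C" := (real_complex R x) : ring_scope.

Lemma psdmx_gram m n (A : 'M[C]_(m, n)) : psdmx (adj A *m A).
Proof.
move=> v; rewrite mulmxA -adjmxM -mulmxA mxE sumr_ge0 // => i _.
by rewrite adjmxE mulrC mulcJ_ge0.
Qed.

Lemma psdmx_conj m n (A : 'M[C]_n) (B : 'M[C]_(n, m)) :
  psdmx A -> psdmx (adj B *m A *m B).
Proof. by move=> pA v; have := pA (B *m v); rewrite adjmxM !mulmxA. Qed.

Lemma psdmx0 n : psdmx (0 : 'M[C]_n).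
Proof. by move=> v; rewrite mulmx0 mul0mx mxE. Qed.

Lemma psdmxD n (A B : 'M[C]_n) : psdmx A -> psdmx B -> psdmx (A + B).
Proof. by move=> pA pB v; rewrite mulmxDr mulmxDl mxE addr_ge0. Qed.

Lemma psdmx_sum (I : finType) (P : pred I) n (F : I -> 'M[C]_n) :
  (forall i, P i -> psdmx (F i)) -> psdmx (\sum_(i | P i) F i).
Proof.
move=> h; apply: big_ind; [exact: psdmx0|move=> A B; exact: psdmxD|exact: h].
Qed.

Lemma psdmxZ n (a : R) (A : 'M[C]_n) : 0 <= a -> psdmx A -> psdmx (a%:C *: A).
Proof.
by move=> a0 pA v; rewrite -scalemxAr -scalemxAl mxE mulr_ge0 ?ler0c.
Qed.

Lemma psdmx1 n : psdmx (1%:M : 'M[C]_n).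
Proof. by have := @psdmx_gram n n 1%:M; rewrite adjmx1 mul1mx. Qed.

Lemma form_delta n (A : 'M[C]_n) (i j : 'I_n) :
  ((adj (delta_mx i ord0 : 'cV[C]_n) *m A) *m (delta_mx j ord0 : 'cV[C]_n))
    ord0 ord0 = A i j.
Proof.
have -> : adj (delta_mx i ord0 : 'cV[C]_n) = delta_mx ord0 i.
  by apply/matrixP=> a b; rewrite !mxE andbC; case: (_ && _); rewrite /= ?oppr0.
by rewrite -rowE -colE !mxE.
Qed.

(* Polarization: the test vectors e_i + e_j and e_i + 'i e_j force A_ji = conj A_ij. *)
Lemma psdmx_herm n (A : 'M[C]_n) : psdmx A -> adj A = A.
Proof.
move=> pA; apply/matrixP=> j i; rewrite adjmxE.
pose e k : 'cV[C]_n := delta_mx k 0.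
have real k : complex.Im (A k k) = 0.
  by apply: ger0_Im; have := pA (e k); rewrite form_delta.
have h (z : C) : complex.Im (conjc z * A j i + z * A i j) = 0.
  have := ger0_Im (pA (e i + z *: e j)).
  rewrite adjmxD !(mulmxDl, mulmxDr).
  have -> : adj (z *: e j) = conjc z *: adj (e j).
    by apply/matrixP=> a b; rewrite !mxE rmorphM.
  rewrite -?(scalemxAl, scalemxAr) !mxE.
  have E u v : (\sum_k (adj (e u) *m A) ord0 k * e v k ord0) = A u v.
    by rewrite -[RHS]form_delta mxE.
  rewrite !E.
  move: (real i) (real j).
  case: (A i i) (A j j) (A i j) (A j i) z => [? ?] [? ?] [a b] [c d] [x y] /=.
  by move=> -> ->; rewrite !(mulr0, mul0r, addr0, add0r); lra.
have := h 1; have := h (Complex 0 1).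
case: (A i j) (A j i) => [a b] [c d] /= h1 h2.
by congr Complex; move: h1 h2; rewrite !(mulr0, mul0r, addr0, add0r, mul1r, oppr0, subr0); lra.
Qed.

Lemma psdmx_tr_ge0 n (A : 'M[C]_n) : psdmx A -> 0 <= \tr A.
Proof.
by move=> pA; apply: sumr_ge0 => i _; have := pA (delta_mx i 0); rewrite form_delta.
Qed.

End PSD.

(** * Spectral calculus and real traces *)

Section Spectral.
Variable R : realType.
Local Notation C := R[i].
Local Notation adj := (@adjmx R _ _).
Local Notation "x %:C" := (real_complex R x) : ring_scope.

Definition unitary n (U : 'M[C]_n) := adj U *m U = 1%:M.

(** Serves as a functional calculus: functions of one Hermitian operator share the eigenbasis [U],
    so their order, products and traces reduce to statements about eigenvalues. *)
Definition usp n (U : 'M[C]_n) (d : 'I_n -> R) : 'M[C]_n :=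
  U *m diag_mx (\row_j (d j)%:C) *m adj U.

Lemma unitaryV n (U : 'M[C]_n) : unitary U -> U *m adj U = 1%:M.
Proof. exact: mulmx1C. Qed.

Lemma unitary_adj n (U : 'M[C]_n) : unitary U -> unitary (adj U).
Proof. by move=> uU; rewrite /unitary adjmxK unitaryV. Qed.

Lemma unitaryM n (U V : 'M[C]_n) : unitary U -> unitary V -> unitary (U *m V).
Proof.
by move=> uU uV; rewrite /unitary adjmxM -mulmxA (mulmxA (adj U)) uU mul1mx.
Qed.

Lemma herm_usp n (A : 'M[C]_n) : adj A = A ->
  exists U d, unitary U /\ A = usp U d.
Proof.
move=> hA.
have hh : A \is hermsymmx.
  apply/is_hermitianmxP; rewrite expr0 scale1r -[in LHS]hA /adjmx.
  by rewrite map_trmx.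
have /mxOverP rd := hermitian_spectral_diag_real hh.
have /orthomx_spectralP AE := hermitian_normalmx hh.
have uP := spectral_unitarymx A; rewrite (invmx_unitary uP) in AE.
have adjE : map_mx Num.Def.conjC (spectralmx A)^T = adj (spectralmx A).
  by rewrite /adjmx map_trmx.
rewrite adjE in AE.
exists (adj (spectralmx A)), (fun j => complex.Re (spectral_diag A ord0 j)); split.
  by rewrite /unitary adjmxK -adjE; apply/unitarymxP.
rewrite {1}AE /usp adjmxK; congr (_ *m _ *m _); congr diag_mx.
apply/rowP=> j; rewrite mxE; apply/esym/RRe_real/rd.
Qed.

Section Usp.
Variables (n : nat) (U : 'M[C]_n).
Hypothesis uU : unitary U.

Lemma usp_eq f g : f =1 g -> usp U f = usp U g.
Proof. by move=> fg; congr (_ *m diag_mx _ *m _); apply/rowP=> j; rewrite !mxE fg. Qed.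

Lemma adj_usp f : adj (usp U f) = usp U f.
Proof.
rewrite /usp !adjmxM adjmxK mulmxA; congr (_ *m _ *m _).
apply/matrixP=> i j; rewrite !mxE eq_sym.
by case: eqP => [->|_]; rewrite ?mulr1n ?mulr0n /= oppr0.
Qed.

Lemma uspD f g : usp U f + usp U g = usp U (f \+ g).
Proof.
rewrite /usp -mulmxDl -mulmxDr -linearD; congr (_ *m diag_mx _ *m _).
by apply/rowP=> j; rewrite !mxE rmorphD.
Qed.

Lemma uspZ a f : a%:C *: usp U f = usp U (fun j => a * f j).
Proof.
rewrite /usp scalemxAl scalemxAr -linearZ; congr (_ *m diag_mx _ *m _).
by apply/rowP=> j; rewrite !mxE rmorphM.
Qed.

Lemma usp1 : usp U (fun=> 1) = 1%:M.
Proof.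
rewrite /usp (_ : diag_mx _ = 1%:M) ?mulmx1 ?unitaryV //.
by apply/matrixP=> i j; rewrite !mxE rmorph1.
Qed.

Lemma usp_cst a : usp U (fun=> a) = a%:C%:M.
Proof. by rewrite -[RHS]scalemx1 -usp1 uspZ; apply: usp_eq=> j; rewrite mulr1. Qed.

Lemma uspB f g : usp U f - usp U g = usp U (fun j => f j - g j).
Proof.
rewrite -[usp U g]scale1r -scaleNr.
have -> : -1 = (-1)%:C by rewrite rmorphN rmorph1.
by rewrite uspZ uspD; apply: usp_eq=> j /=; rewrite mulN1r.
Qed.

Lemma uspM f g : usp U f *m usp U g = usp U (fun j => f j * g j).
Proof.
rewrite /usp !mulmxA; congr (_ *m _).
rewrite -(mulmxA _ (adj U) U) uU mulmx1 -mulmxA mulmx_diag; congr (_ *m diag_mx _).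
by apply/rowP=> j; rewrite !mxE rmorphM.
Qed.

Lemma usp_tr f : \tr (usp U f) = (\sum_j f j)%:C.
Proof.
rewrite /usp mxtrace_mulC mulmxA uU mul1mx mxtrace_diag rmorph_sum.
by apply: eq_bigr=> j _; rewrite mxE.
Qed.

Lemma usp_psd f : (forall j, 0 <= f j) -> psdmx (usp U f).
Proof.
move=> f0; have -> : usp U f = adj (usp U (Num.sqrt \o f)) *m usp U (Num.sqrt \o f).
  by rewrite adj_usp uspM; apply: usp_eq=> j /=; rewrite -expr2 sqr_sqrtr.
exact: psdmx_gram.
Qed.

Lemma usp_diag f : adj U *m usp U f *m U = diag_mx (\row_j (f j)%:C).
Proof. by rewrite /usp !mulmxA uU mul1mx -mulmxA uU mulmx1. Qed.

Lemma usp_psd_ge0 f : psdmx (usp U f) -> forall j, 0 <= f j.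
Proof.
move=> /(psdmx_conj U) + j; rewrite usp_diag => /(_ (delta_mx j ord0)).
by rewrite form_delta !mxE eqxx mulr1n ler0c.
Qed.

End Usp.

Lemma psd_usp n (A : 'M[C]_n) : psdmx A ->
  exists U d, [/\ unitary U, A = usp U d & forall j, 0 <= d j].
Proof.
move=> pA; have [U [d [uU AE]]] := herm_usp (psdmx_herm pA).
by exists U, d; split=> //; apply: (usp_psd_ge0 uU); rewrite -AE.
Qed.

Lemma psd_gramP n (A : 'M[C]_n) : psdmx A -> exists B : 'M[C]_n, A = adj B *m B.
Proof.
move=> /psd_usp[U [d [uU -> d0]]]; exists (usp U (Num.sqrt \o d)).
by rewrite adj_usp (uspM uU); apply: usp_eq=> j /=; rewrite -expr2 sqr_sqrtr.
Qed.

(** The traces that matter are real but live in [R[i]]; the real part moves all estimates into the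
    ordered field [R]. *)
Definition Rtr n (A : 'M[C]_n) : R := complex.Re (\tr A).

Lemma Re_rC (a : R) (z : C) : complex.Re (a%:C * z) = a * complex.Re z.
Proof. by case: z => x y /=; rewrite mul0r subr0. Qed.

Lemma ReD (x y : C) : complex.Re (x + y) = complex.Re x + complex.Re y.
Proof. by case: x y => [? ?] [? ?]. Qed.

Lemma ReN (x : C) : complex.Re (- x) = - complex.Re x.
Proof. by case: x. Qed.

Lemma Re_sum (I : Type) (r : seq I) (P : pred I) (F : I -> C) :
  complex.Re (\sum_(i <- r | P i) F i) = \sum_(i <- r | P i) complex.Re (F i).
Proof. by elim/big_rec2: _ => //= i y1 y2 _ <-; rewrite ReD. Qed.

Lemma RtrD n (A B : 'M[C]_n) : Rtr (A + B) = Rtr A + Rtr B.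
Proof. by rewrite /Rtr mxtraceD ReD. Qed.

Lemma RtrN n (A : 'M[C]_n) : Rtr (- A) = - Rtr A.
Proof. by rewrite /Rtr (raddfN (@mxtrace _ n)) ReN. Qed.

Lemma RtrB n (A B : 'M[C]_n) : Rtr (A - B) = Rtr A - Rtr B.
Proof. by rewrite RtrD RtrN. Qed.

Lemma Rtr_sum (I : Type) (r : seq I) (P : pred I) n (F : I -> 'M[C]_n) :
  Rtr (\sum_(i <- r | P i) F i) = \sum_(i <- r | P i) Rtr (F i).
Proof. by rewrite /Rtr (raddf_sum (@mxtrace _ n)) Re_sum. Qed.

Lemma RtrZ n a (A : 'M[C]_n) : Rtr (a%:C *: A) = a * Rtr A.
Proof. by rewrite /Rtr mxtraceZ Re_rC. Qed.

Lemma RtrC m n (A : 'M[C]_(m, n)) B : Rtr (A *m B) = Rtr (B *m A).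
Proof. by rewrite /Rtr mxtrace_mulC. Qed.

Lemma Rtr_psd n (A : 'M[C]_n) : psdmx A -> 0 <= Rtr A.
Proof. by move=> /psdmx_tr_ge0; rewrite /Rtr lecE => /andP[_]. Qed.

(** With A = [adj D *m D] the trace is that of [D *m B *m adj D], which is positive although A B
    need not be Hermitian. *)
Lemma Rtr_psdM n (A B : 'M[C]_n) : psdmx A -> psdmx B -> 0 <= Rtr (A *m B).
Proof.
move=> /psd_gramP[D ->] pB; rewrite -mulmxA RtrC -mulmxA; apply: Rtr_psd.
by have := psdmx_conj (adj D) pB; rewrite adjmxK mulmxA.
Qed.

Lemma Rtr_leM n (P A B : 'M[C]_n) : psdmx P -> lemx A B ->
  Rtr (P *m A) <= Rtr (P *m B).
Proof. by move=> pP AB; rewrite -subr_ge0 -RtrB -mulmxBr; apply: Rtr_psdM. Qed.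

Lemma Rtr_density n (A : 'M[C]_n) : density A -> Rtr A = 1.
Proof. by case=> _; rewrite /Rtr => ->. Qed.

End Spectral.

Section Loewner.
Variables (R : realType) (n : nat).
Local Notation C := R[i].
Local Notation adj := (@adjmx R _ _).
Local Notation "x %:C" := (real_complex R x) : ring_scope.
Implicit Types A B D E : 'M[C]_n.

Lemma lemx_refl A : lemx A A.
Proof. by rewrite /lemx subrr; apply: psdmx0. Qed.

Lemma lemx_trans B A D : lemx A B -> lemx B D -> lemx A D.
Proof. by move=> h1 h2; have := psdmxD h2 h1; rewrite addrA subrK. Qed.

Lemma lemxD A B D E : lemx A B -> lemx D E -> lemx (A + D) (B + E).
Proof. by move=> h1 h2; have := psdmxD h1 h2; rewrite addrACA -opprD. Qed.

Lemma lemxZ a A B : 0 <= a -> lemx A B -> lemx (a%:C *: A) (a%:C *: B).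
Proof. by move=> a0 h; rewrite /lemx -scalerBr; apply: psdmxZ. Qed.

Lemma lemx_conj A B (D : 'M[C]_n) :
  lemx A B -> lemx (adj D *m A *m D) (adj D *m B *m D).
Proof. by move=> h; rewrite /lemx -mulmxBl -mulmxBr; apply: psdmx_conj. Qed.

Lemma lemx_term_sum (I : finType) (F : I -> 'M[C]_n) i :
  (forall j, psdmx (F j)) -> lemx (F i) (\sum_j F j).
Proof.
move=> pF; rewrite /lemx (bigD1 i) // addrAC subrr add0r.
by apply: psdmx_sum => j _; exact: pF.
Qed.

End Loewner.

(** * Entropy and tensor products *)

Section Entropy.
Variable R : realType.
Local Notation C := R[i].
Local Notation adj := (@adjmx R _ _).
Local Notation "x %:C" := (real_complex R x) : ring_scope.

Lemma char_poly_usp n (U : 'M[C]_n) d : unitary U ->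
  char_poly (usp U d) = \prod_j ('X - (d j)%:C%:P).
Proof.
move=> uU; pose D : 'M[C]_n := diag_mx (\row_j (d j)%:C).
have -> : \prod_j ('X - (d j)%:C%:P) = char_poly D.
  rewrite char_poly_trig; first by apply: eq_bigr=> j _; rewrite !mxE eqxx mulr1n.
  by rewrite diag_mx_is_trig.
rewrite /char_poly; have E : map_mx polyC U *m map_mx polyC (adj U) = 1%:M.
  by rewrite -map_mxM unitaryV // map_scalar_mx.
have -> : char_poly_mx (usp U d) =
    map_mx polyC U *m char_poly_mx D *m map_mx polyC (adj U).
  rewrite /char_poly_mx mulmxBr mulmxBl /usp !map_mxM; congr (_ - _).
  by rewrite scalar_mxC -mulmxA E mulmx1.
by rewrite !det_mulmx mulrAC -det_mulmx E det1 mul1r.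
Qed.

(** [spectrum] is an arbitrary list of roots of the characteristic polynomial; unique factorization
    fixes it up to order, so the entropy does not depend on the choice. The factor [ln 2] passes
    from bits to nats. *)
Lemma vN_entropy_usp n (U : 'M[C]_n) d : unitary U ->
  ln 2 * vN_entropy (usp U d) = - \sum_j d j * ln (d j).
Proof.
move=> uU; have l2 : ln 2 != 0 :> R by rewrite gt_eqF // ln_gt0 // ltr1n.
have E : perm_eq (spectrum (usp U d)) [seq (d j)%:C | j <- index_enum 'I_n].
  apply: prod_XsubC_eq; rewrite big_map -(char_poly_usp d uU).
  apply/esym; rewrite /spectrum.
  apply: (@xgetI _ [::] [set s | char_poly (usp U d) = \prod_(z <- s) ('X - z%:P)]
     [seq (d j)%:C | j <- index_enum 'I_n]) => /=.
  by rewrite big_map char_poly_usp.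
rewrite /vN_entropy (perm_big _ E) big_map mulrN mulr_sumr; congr (- _).
apply: eq_bigr=> j _; rewrite /xlog2x /log2; case: eqP => [/= ->|_ /=].
  by rewrite mulr0 mul0r.
by rewrite mulrCA; congr (_ * _); rewrite mulrCA divff // mulr1.
Qed.

End Entropy.

(** * Marginals of product distributions *)

Section ProductSums.
Variable R : comPzRingType.

Lemma sum_ffun_prod (I J : finType) (F : I -> J -> R) :
  \sum_(f : {ffun I -> J}) \prod_i F i (f i) = \prod_i \sum_j F i j.
Proof. by rewrite bigA_distr_bigA. Qed.

Lemma sum_ffun_marginal (I J : finType) (w : I -> J -> R) (k : I) (g : J -> R) :
  (forall i, \sum_j w i j = 1) ->
  \sum_(f : {ffun I -> J}) (\prod_i w i (f i)) * g (f k) = \sum_j w k j * g j.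
Proof.
move=> w1; pose F i j := w i j * (if i == k then g j else 1).
transitivity (\sum_(f : {ffun I -> J}) \prod_i F i (f i)).
  apply: eq_bigr=> f _; rewrite big_split /=; congr (_ * _).
  by rewrite (bigD1 k) //= eqxx big1 ?mulr1 // => i /negbTE ->.
rewrite sum_ffun_prod (bigD1 k) //= [X in _ * X]big1 ?mulr1.
  by apply: eq_bigr=> j _; rewrite /F eqxx.
by move=> i /negbTE ik; rewrite -[RHS](w1 i); apply: eq_bigr=> j _; rewrite /F ik mulr1.
Qed.

(** Distinct coordinates of a product distribution are independent. An indicator first pins the
    value at [k] to j; then [g j] depends on the coordinate [k'] alone and joins its factor. *)
Lemma sum_ffun_marginal2 (I J : finType) (w : I -> J -> R) (k k' : I)
    (g : J -> J -> R) : k != k' ->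
  (forall i, \sum_j w i j = 1) ->
  \sum_(f : {ffun I -> J}) (\prod_i w i (f i)) * g (f k) (f k') =
  \sum_j \sum_j' w k j * w k' j' * g j j'.
Proof.
move=> kk' w1.
transitivity (\sum_j \sum_(f : {ffun I -> J})
    (\prod_i (w i (f i) * (if i == k then (f i == j)%:R else 1))) * g j (f k')).
  rewrite exchange_big /=; apply: eq_bigr=> f _.
  rewrite (bigD1 (f k)) //= [X in _ + X]big1 ?addr0 => [|j /negbTE jk].
    congr (_ * _); rewrite big_split /= -[LHS]mulr1; congr (_ * _).
    rewrite (bigD1 k) //= eqxx big1 ?mulr1 ?eqxx // => i /negbTE ->//.
  by rewrite (bigD1 k) //= !eqxx eq_sym jk mulr0 !mul0r.
apply: eq_bigr=> j _.
pose F i j' := w i j' * (if i == k then (j' == j)%:R else 1) *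
   (if i == k' then g j j' else 1).
transitivity (\sum_(f : {ffun I -> J}) \prod_i F i (f i)).
  apply: eq_bigr=> f _; rewrite [in RHS]big_split /=; congr (_ * _).
  by rewrite (bigD1 k') //= eqxx big1 ?mulr1 // => i /negbTE ->.
rewrite sum_ffun_prod (bigD1 k) //= (bigD1 k') /=; last by rewrite eq_sym.
rewrite [X in _ * (_ * X)]big1 ?mulr1; last first.
  move=> i /andP[/negbTE ik /negbTE ik']; rewrite -[RHS](w1 i).
  by apply: eq_bigr=> j' _; rewrite /F ik ik' !mulr1.
have -> : \sum_j0 F k j0 = w k j.
  rewrite (bigD1 j) //= big1 ?addr0 /F ?eqxx ?(negbTE kk') ?mulr1 //.
  by move=> i /negbTE ->; rewrite mulr0 mul0r.
rewrite mulr_sumr; apply: eq_bigr=> j' _.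
by rewrite /F eqxx [k' == k]eq_sym (negbTE kk') mulr1 mulrA.
Qed.

End ProductSums.

(** * Tensor powers in coordinates *)

Section Digits.

(** Follows the recursion of [tenspow_seq], so that an index of the tensor power becomes a tuple of
    l base indices. *)
Fixpoint digit n l : 'I_(n ^ l) -> {ffun 'I_l -> 'I_n} :=
  match l return 'I_(n ^ l) -> {ffun 'I_l -> 'I_n} with
  | 0 => fun=> ffun0 (card_ord 0)
  | l'.+1 => fun i =>
    let ab := mxtens_unindex (cast_ord (expnS n l') i) in
    [ffun k => if unlift ord0 k is Some k' then digit ab.2 k' else ab.1]
  end.

Lemma digitSE n l (i : 'I_(n ^ l.+1)) a b :
  mxtens_unindex (cast_ord (expnS n l) i) = (a, b) ->
  forall k, digit i k = if unlift ord0 k is Some k' then digit b k' else a.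
Proof. by move=> E k; move: a b E => a b [<- <-]; rewrite ffunE. Qed.

Lemma digit_inj n l : injective (@digit n l).
Proof.
elim: l => [|l IH] i j.
  by move=> _; apply: val_inj; case: i j => [[|i] ?] [[|j] ?].
move=> /ffunP E; apply: (@cast_ord_inj _ _ (expnS n l)).
apply: (can_inj (@mxtens_unindexK n (n ^ l))).
case E1: (mxtens_unindex (cast_ord _ i)) => [a b].
case E2: (mxtens_unindex (cast_ord _ j)) => [c d].
have := E ord0; rewrite (digitSE E1) (digitSE E2) unlift_none => ->; congr (_, _).
apply: IH; apply/ffunP=> k; have := E (lift ord0 k).
by rewrite (digitSE E1) (digitSE E2) liftK.
Qed.

Lemma digit_bij n l : bijective (@digit n l).
Proof. by apply: inj_card_bij (@digit_inj n l) _; rewrite card_ffun !card_ord. Qed.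

Lemma sum_digit (R : nmodType) n l (F : {ffun 'I_l -> 'I_n} -> R) :
  \sum_(i < n ^ l) F (digit i) = \sum_f F f.
Proof.
rewrite [RHS](reindex (@digit n l)) //; apply: onW_bij; exact: digit_bij.
Qed.

Lemma digit_cast (n l l' : nat) (E : l = l') (e : (n ^ l = n ^ l')%N) (i : 'I_(n ^ l')) k :
  digit (cast_ord (esym e) i) k = digit i (cast_ord E k).
Proof.
case: l' / E e i => e i; rewrite cast_ord_id.
by congr (digit _ _); apply: val_inj.
Qed.

End Digits.

Section TensorProduct.
Variable R : realType.
Local Notation C := R[i].
Local Notation adj := (@adjmx R _ _).
Local Notation "x %:C" := (real_complex R x) : ring_scope.

(** The tensor product of the A k by an entry formula, free of casts and of recursion, which also
    allows different factors at different positions. *)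
Definition tp n l (A : 'I_l -> 'M[C]_n) : 'M[C]_(n ^ l) :=
  \matrix_(i, j) \prod_k A k (digit i k) (digit j k).

Lemma ord_pow0 n (i j : 'I_(n ^ 0)) : i = j.
Proof.
case: i j => [i Hi] [j Hj]; apply: val_inj; move: Hi Hj => /=.
by rewrite expn0 !ltnS !leqn0 => /eqP -> /eqP ->.
Qed.

Lemma tenspow_seqE (X : Type) n (W : X -> 'M[C]_n) (x0 : X) (xs : seq X) :
  tenspow_seq W xs = tp (fun k : 'I_(size xs) => W (nth x0 xs k)).
Proof.
elim: xs => [|x xs IH].
  apply/matrixP=> i j; rewrite castmxE !mxE big_ord0.
  by rewrite (ord_pow0 i j) eqxx.
apply/matrixP=> i j.
have -> : tenspow_seq W (x :: xs) =
  castmx (esym (expnS n (size xs)), esym (expnS n (size xs)))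
    (W x *t tenspow_seq W xs) by [].
rewrite castmxE mxE IH !mxE !esymK big_ord_recl.
rewrite !(digitSE (surjective_pairing _)) unlift_none; congr (_ * _).
by apply: eq_bigr=> k _; rewrite !(digitSE (surjective_pairing _)) liftK.
Qed.

Lemma tenspowE (X : Type) n l (W : X -> 'M[C]_n) (u : l.-tuple X) :
  tenspow W u = tp (fun k => W (tnth u k)).
Proof.
apply/matrixP=> i j; rewrite /tenspow castmxE.
(* [nth] needs a default letter, which need not exist for l = 0; otherwise the head of [u] supplies
   it. *)
case: l u i j => [|l] u i j.
  move: (congr1 _ _) => /= e; case: u e => [[|//] p] /= e.
  rewrite castmxE !mxE big_ord0 /=.
  by rewrite (ord_pow0 i j) eqxx.
have x0 : X := thead u.
rewrite (tenspow_seqE W x0) !mxE.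
rewrite (reindex (cast_ord (esym (size_tuple u)))) /=; last first.
  by exists (cast_ord (size_tuple u)) => k _; rewrite ?cast_ordK ?cast_ordKV.
apply: eq_bigr=> k _; rewrite !(digit_cast (size_tuple u)) cast_ordKV.
by rewrite (tnth_nth x0).
Qed.

End TensorProduct.

Section TensorAlgebra.
Variable R : realType.
Local Notation C := R[i].
Local Notation adj := (@adjmx R _ _).
Local Notation "x %:C" := (real_complex R x) : ring_scope.
Variables n l : nat.
Implicit Types A B U : 'I_l -> 'M[C]_n.

Lemma eq_tp A B : A =1 B -> tp A = tp B.
Proof. by move=> AB; apply/matrixP=> i j; rewrite !mxE; apply: eq_bigr=> k _; rewrite AB. Qed.

Lemma tpM A B : tp A *m tp B = tp (fun k => A k *m B k).
Proof.
apply/matrixP=> i j; rewrite !mxE.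
transitivity (\sum_(c < n ^ l)
    \prod_k (A k (digit i k) (digit c k) * B k (digit c k) (digit j k))).
  by apply: eq_bigr=> c _; rewrite !mxE -big_split.
rewrite (sum_digit (fun f : {ffun 'I_l -> 'I_n} =>
  \prod_k (A k (digit i k) (f k) * B k (f k) (digit j k)))).
by rewrite (sum_ffun_prod (fun k a => A k (digit i k) a * B k a (digit j k)));
  apply: eq_bigr=> k _; rewrite mxE.
Qed.

Lemma tp_adj A : adj (tp A) = tp (fun k => adj (A k)).
Proof.
by apply/matrixP=> i j; rewrite !mxE rmorph_prod; apply: eq_bigr=> k _; rewrite !mxE.
Qed.

Lemma tp_diag (d : 'I_l -> 'I_n -> R) :
  tp (fun k => diag_mx (\row_j (d k j)%:C)) =
  diag_mx (\row_i (\prod_k d k (digit i k))%:C).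
Proof.
apply/matrixP=> i j; rewrite !mxE.
case: eqP => [<-|ij]; rewrite ?mulr1n ?mulr0n.
  by rewrite rmorph_prod; apply: eq_bigr=> k _; rewrite !mxE eqxx mulr1n.
have [k dk] : exists k, digit i k != digit j k.
  apply/existsP; apply: contra_notT ij; rewrite negb_exists => /forallP h.
  apply: digit_inj; apply/ffunP=> k; apply/eqP.
  by have := h k; rewrite negbK.
by rewrite (bigD1 k) //= !mxE (negbTE dk) mulr0n mul0r.
Qed.

Lemma tp1 : tp (fun=> 1%:M) = 1%:M :> 'M[C]_(n ^ l).
Proof.
transitivity (tp (fun (_ : 'I_l) => diag_mx (\row_(j < n) (1 : R)%:C))).
  apply: eq_tp=> k; apply/matrixP=> i j; rewrite !mxE; by case: eqP.
rewrite tp_diag; apply/matrixP=> i j; rewrite !mxE big1 //.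
Qed.

Lemma tp_unitary U : (forall k, unitary (U k)) -> unitary (tp U).
Proof. by move=> uU; rewrite /unitary tp_adj tpM -tp1; apply: eq_tp. Qed.

Lemma tp_usp U (d : 'I_l -> 'I_n -> R) :
  tp (fun k => usp (U k) (d k)) = usp (tp U) (fun i => \prod_k d k (digit i k)).
Proof. by rewrite /usp -tp_diag tp_adj !tpM. Qed.

Lemma tp_tr A : \tr (tp A) = \prod_k \tr (A k).
Proof.
transitivity (\sum_(i < n ^ l) \prod_k A k (digit i k) (digit i k)).
  by apply: eq_bigr=> i _; rewrite mxE.
rewrite (sum_digit (fun f : {ffun _ -> _} => \prod_k A k (f k) (f k))).
by rewrite (sum_ffun_prod (fun k a => A k a a)).
Qed.

Lemma tp_psd A : (forall k, psdmx (A k)) -> psdmx (tp A).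
Proof.
move=> /(_ _)/psd_gramP/cid pA; pose B k := sval (pA k).
have -> : tp A = adj (tp B) *m tp B.
  by rewrite tp_adj tpM; apply: eq_tp=> k; rewrite /B; case: (pA k).
exact: psdmx_gram.
Qed.

Lemma tp_density A : (forall k, density (A k)) -> density (tp A).
Proof.
move=> dA; split; first by apply: tp_psd => k; case: (dA k).
by rewrite tp_tr big1 // => k _; case: (dA k).
Qed.

Lemma tpZ (c : 'I_l -> R) A :
  tp (fun k => (c k)%:C *: A k) = (\prod_k c k)%:C *: tp A.
Proof.
apply/matrixP=> i j; rewrite !mxE rmorph_prod -big_split /=.
by apply: eq_bigr=> k _; rewrite mxE.
Qed.

Lemma tp_sum (X : finType) (F : 'I_l -> X -> 'M[C]_n) :
  tp (fun k => \sum_x F k x) = \sum_(f : {ffun 'I_l -> X}) tp (fun k => F k (f k)).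
Proof.
apply/matrixP=> i j; rewrite mxE summxE.
transitivity (\prod_k \sum_x F k x (digit i k) (digit j k)).
  by apply: eq_bigr=> k _; rewrite summxE.
rewrite -(sum_ffun_prod (fun k x => F k x (digit i k) (digit j k))).
by apply: eq_bigr=> f _; rewrite mxE.
Qed.

(** Expanding the product of the B k = A k + (B k - A k) gives positive terms, one of which is
    [tp A]. *)
Lemma tp_lemx A B : (forall k, psdmx (A k)) -> (forall k, lemx (A k) (B k)) ->
  lemx (tp A) (tp B).
Proof.
move=> pA AB; pose F k (b : bool) := if b then A k else B k - A k.
have -> : tp B = tp (fun k => \sum_b F k b).
  by apply: eq_tp=> k; rewrite big_bool /= addrC subrK.
rewrite tp_sum (bigD1 [ffun=> true]) //=.
have -> : tp (fun k => F k ([ffun=> true] k)) = tp A.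
  by apply: eq_tp=> k; rewrite ffunE.
rewrite /lemx addrAC subrr add0r; apply: psdmx_sum => f _; apply: tp_psd => k.
by rewrite /F; case: (f k); [exact: pA|exact: AB].
Qed.

Lemma tp_mix (X : finType) (p : X -> R) (W : X -> 'M[C]_n) :
  \sum_(f : {ffun 'I_l -> X}) (\prod_k p (f k))%:C *: tp (fun k => W (f k)) =
  tp (fun=> \sum_x (p x)%:C *: W x).
Proof. by rewrite tp_sum; apply: eq_bigr=> f _; rewrite -tpZ. Qed.

End TensorAlgebra.

Lemma mixture_density (R : realType) (X : finType) n (p : X -> R) (W : X -> 'M[R[i]]_n) :
  is_distr p -> cq_channel W -> density (\sum_x (real_complex R (p x)) *: W x).
Proof.
move=> [p0 p1] dW; split.
  by apply: psdmx_sum => x _; apply: psdmxZ; [exact: p0|case: (dW x)].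
rewrite (raddf_sum (@mxtrace _ n)) /=.
transitivity (\sum_x real_complex R (p x)); last by rewrite -rmorph_sum p1.
by apply: eq_bigr=> x _; rewrite mxtraceZ (proj2 (dW x)) mulr1.
Qed.

(** * Operator inequalities *)

(** Once products are expanded, each is made an opaque matrix; what remains is linear and is checked
    entrywise. *)
Ltac mx_linear :=
  repeat match goal with
  | |- context [ @mulmx ?R ?m ?n ?p ?A ?B ] => move: (@mulmx R m n p A B) => ?
  end;
  apply/matrixP => ? ?; rewrite !mxE; ring.

Section OperatorInequalities.
Variables (R : realType) (n : nat).
Local Notation C := R[i].
Local Notation adj := (@adjmx R _ _).
Local Notation "x %:C" := (real_complex R x) : ring_scope.
Implicit Types A B E F P Q S T X Y : 'M[C]_n.

(** The parallelogram identity: the difference of the two sides is [adj (X - Y) *m Q *m (X - Y)]. *)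
Lemma lemx_mul2 Q X Y : psdmx Q ->
  lemx (adj (X + Y) *m Q *m (X + Y))
       (2%:C *: (adj X *m Q *m X + adj Y *m Q *m Y)).
Proof.
move=> pQ; have := psdmx_conj (X - Y) pQ; rewrite /lemx; congr psdmx.
rewrite !(adjmxB, adjmxD, mulmxBl, mulmxBr, mulmxDl, mulmxDr, mulNmx, mulmxN).
have -> : 2%:C = 2 :> C by rewrite rmorph_nat.
mx_linear.
Qed.

Lemma lemx_sqr A : psdmx A -> lemx A 1%:M -> lemx (A *m A) A.
Proof.
move=> /psd_usp[U [d [uU -> d0]]]; rewrite /lemx -(usp1 uU) uspB => h.
rewrite (uspM uU) uspB; apply: (usp_psd uU) => j.
have := usp_psd_ge0 uU h j; have := d0 j; nra.
Qed.

(** Operator monotonicity of the square root. For H = T - A one has T^2 - A^2 = T H + H A; in an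
    eigenbasis of H its j-th diagonal entry is d_j (T_jj + A_jj), and d_j = T_jj - A_jj. If d_j < 0,
    positivity forces T_jj = A_jj = 0 and hence d_j = 0. *)
Lemma lemx_sqrt A T : psdmx A -> psdmx T -> lemx (A *m A) (T *m T) -> lemx A T.
Proof.
move=> pA pT AT.
have hH : adj (T - A) = T - A by rewrite adjmxB !psdmx_herm.
have [U [d [uU HE]]] := herm_usp hH.
rewrite /lemx HE; apply: usp_psd => // j; rewrite leNgt; apply/negP => dj.
pose T' := adj U *m T *m U; pose A' := adj U *m A *m U.
have pT' : psdmx T' by apply: psdmx_conj.
have pA' : psdmx A' by apply: psdmx_conj.
have diag : T' - A' = diag_mx (\row_j (d j)%:C).
  by rewrite -(usp_diag uU) -HE mulmxBr mulmxBl.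
have TE : T' = A' + diag_mx (\row_j (d j)%:C) by rewrite -diag addrC subrK.
have p2 : psdmx (T' *m T' - A' *m A').
  have := psdmx_conj U AT; congr psdmx.
  clear -uU.
  have sq (Z : 'M[C]_n) : adj U *m Z *m U *m (adj U *m Z *m U) = adj U *m (Z *m Z) *m U.
    by rewrite !mulmxA -(mulmxA (adj U *m Z) U (adj U)) (unitaryV uU) mulmx1.
  by rewrite /T' /A' !sq mulmxBr mulmxBl.
clearbody T' A'.
have E2 : T' *m T' - A' *m A' = T' *m diag_mx (\row_j (d j)%:C) + diag_mx (\row_j (d j)%:C) *m A'.
  rewrite -diag; clear; rewrite !(mulmxBr, mulmxBl, mulNmx, mulmxN); mx_linear.
have pos (Z : 'M[C]_n) : psdmx Z -> 0 <= Z j j.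
  by move=> /(_ (delta_mx j ord0)); rewrite form_delta.
have := pos _ p2; rewrite E2 mxE mul_mx_diag mul_diag_mx !mxE mulrC -mulrDr.
have := pos _ pT'; have := pos _ pA'.
have := congr1 (fun M : 'M[C]_n => M j j) diag; rewrite !mxE eqxx mulr1n.
rewrite !lecE /=; case: (T' j j) (A' j j) => [a b] [a' b'] /= [h1 h2].
move=> /andP[_ h3] /andP[_ h4] /andP[_ h5]; move: h1 h3 h4 h5 dj; rewrite mul0r subr0; clear; generalize (d j) => t; nra.
Qed.

Lemma scalar_rC (a : R) : (a%:C)%:M = a%:C *: 1%:M :> 'M[C]_n.
Proof. by rewrite scalemx1. Qed.

(* With B = T^2 - A the left-hand side is T^-1 B T^-1; expand T^-1 = 1 + (T^-1 - 1). *)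
Lemma hayashi_nagaoka A T Ti : psdmx A -> lemx A 1%:M -> psdmx T -> adj Ti = Ti ->
  Ti *m T = 1%:M -> lemx A (T *m T) ->
  lemx (1%:M - Ti *m A *m Ti)
    (2%:C *: (1%:M - A) + 4%:C *: (T *m T - A)).
Proof.
move=> pA A1 pT hTi TiT AT; set B := T *m T - A.
have TTi : T *m Ti = 1%:M by exact: mulmx1C.
have hT : adj T = T by exact: psdmx_herm.
have LE : 1%:M - Ti *m A *m Ti = adj (1%:M + (Ti - 1%:M)) *m B *m (1%:M + (Ti - 1%:M)).
  have -> : 1%:M + (Ti - 1%:M) = Ti by rewrite addrC subrK.
  rewrite hTi /B mulmxBr mulmxBl mulmxA TiT mul1mx TTi.
  by [].
rewrite LE; apply: lemx_trans (lemx_mul2 _ _ AT) _.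
have AleT : lemx A T.
  apply: (lemx_sqrt pA pT); apply: lemx_trans AT; exact: lemx_sqr.
set Y := Ti - 1%:M; have hY : adj Y = Y by rewrite adjmxB hTi adjmx1.
have YBY : lemx (adj Y *m B *m Y) (1%:M - T - T + T *m T).
  have -> : 1%:M - T - T + T *m T = adj Y *m (T *m T) *m Y.
    have YT : Y *m T = 1%:M - T by rewrite mulmxBl TiT mul1mx.
    have TY : T *m Y = 1%:M - T by rewrite mulmxBr TTi mulmx1.
    rewrite hY mulmxA YT -mulmxA TY !(mulmxBl, mulmxBr, mulmx1, mul1mx).
    mx_linear.
  by apply: lemx_conj; rewrite /lemx /B opprB addrC subrK.
rewrite /lemx in YBY AleT *.
(* By [YBY] the expansion is at most 2 (B + (1 - T)^2), and this falls short of the right-hand side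
   by exactly 4 (T - A), which [AleT] makes positive. *)
have := psdmxD (psdmxZ (ler0n R 2) YBY) (psdmxZ (ler0n R 4) AleT); congr psdmx.
rewrite adjmx1 mul1mx mulmx1.
have -> : 4%:C = 4 :> C by rewrite rmorph_nat.
have -> : 2%:C = 2 :> C by rewrite rmorph_nat.
rewrite /B; mx_linear.
Qed.

(** The two Gram matrices have the same nonzero spectrum; algebraically, a (a - Y) =
    [adj X *m (a - X *m adj X) *m X] + (a - Y)^2 for Y = [adj X *m X]. *)
Lemma lemx_gram_swap X (a : R) : 0 < a ->
  lemx (X *m adj X) (a%:C%:M) -> lemx (adj X *m X) (a%:C%:M).
Proof.
move=> a0 h; have ac : a%:C != 0 by rewrite fmorph_eq0 gt_eqF.
have h1 : psdmx (adj X *m (a%:C%:M - X *m adj X) *m X) by exact: psdmx_conj.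
have h2 := psdmx_gram (a%:C%:M - adj X *m X).
have a0' : 0 <= a^-1 by rewrite invr_ge0 ltW.
have := psdmxZ a0' (psdmxD h1 h2).
congr psdmx; rewrite adjmxB adjmxM adjmxK scalar_rC adjmxZ adjmx1.
rewrite !(mulmxBl, mulmxBr, mulNmx, mulmxN) -!(scalemxAl, scalemxAr) !mulmx1 !mul1mx !mulmxA.
have -> : a^-1%:C = (a%:C)^-1 by rewrite fmorphV.
repeat match goal with
  | |- context [ @mulmx ?R ?m ?n ?p ?A ?B ] => move: (@mulmx R m n p A B) => ?
  end.
by apply/matrixP=> i j; rewrite !mxE; field.
Qed.

(* F serves as a union of the tests: it is hardly worse than each test E below S. *)
Lemma union_test S (a : R) : psdmx S -> 0 < a ->
  exists F, [/\ psdmx F, lemx F 1%:M, lemx (a%:C *: F) S &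
    forall E, psdmx E -> lemx E 1%:M -> lemx E S ->
      lemx (1%:M - F) (2%:C *: (1%:M - E) + (2 * a)%:C%:M)].
Proof.
move=> /psd_usp[U [d [uU -> d0]]] a0.
pose N := usp U (fun j => (d j < a)%R%:R); pose F := usp U (fun j => 1 - (d j < a)%R%:R).
have FE : 1%:M - F = N by rewrite -(usp1 uU) uspB; apply: usp_eq=> j; rewrite opprB addrC subrK.
have hN : adj N = N by exact: adj_usp.
have N1 : lemx N 1%:M.
  by rewrite /lemx -(usp1 uU) uspB; apply: usp_psd => // j; case: (_ < _); rewrite ?subrr ?subr0.
exists F; split.
- by apply: usp_psd => // j; case: (_ < _); rewrite ?subrr ?subr0.
- by rewrite /lemx FE; apply: usp_psd.
- rewrite uspZ /lemx uspB; apply: usp_psd => // j.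
  by case: ltP (d0 j) => h h0; rewrite ?subrr ?subr0 ?mulr0 ?mulr1 ?subr0 // subr_ge0.
move=> E pE E1 ES; rewrite FE.
have hE := psdmx_herm pE.
(* N projects onto the eigenvectors of S with eigenvalue below a, and E is at most S. *)
have NEN : lemx (N *m E *m N) a%:C%:M.
  have := lemx_conj N ES; rewrite hN => h; apply: lemx_trans h _.
  rewrite /N -(usp_cst uU a) (uspM uU) (uspM uU) /lemx uspB.
  apply: usp_psd => // j.
  by case: ltP (d0 j) => h h0; rewrite ?(mul1r, mul0r, mulr1, mulr0) ?subr0 ?subr_ge0 ltW.
have NN : N *m N = N.
  by rewrite /N (uspM uU); apply: usp_eq=> j; case: (_ < _); rewrite ?mulr1 ?mulr0.
have pN : psdmx N by apply: (usp_psd uU) => j.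
clearbody N; clear F FE.
(* Swapping the factors of N E turns E N E into N E^2 N, which is at most N E N. *)
have ENE : lemx (E *m N *m E) a%:C%:M.
  have -> : E *m N *m E = adj (N *m E) *m (N *m E).
    by rewrite adjmxM hN hE -[in RHS]mulmxA (mulmxA N N E) NN mulmxA.
  apply: (lemx_gram_swap a0); rewrite adjmxM hN hE; apply: (lemx_trans _ NEN).
  by have := lemx_conj N (lemx_sqr pE E1); rewrite hN !mulmxA; apply.
have hE1 : adj (1%:M - E) = 1%:M - E by rewrite adjmxB adjmx1 hE.
have pE1 : psdmx (1%:M - E) := E1.
(* N is expanded with 1 = (1 - E) + E on both sides, so that one half is small where E accepts badly
   and the other is [ENE]. *)
have := lemx_mul2 (1%:M - E) E pN.
rewrite subrK adjmx1 mul1mx mulmx1 => h; apply: lemx_trans h _.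
have -> : (2 * a)%:C%:M = 2%:C *: a%:C%:M :> 'M[C]_n by rewrite scale_scalar_mx rmorphM.
rewrite hE1 hE -scalerDr; apply: (lemxZ (ler0n R 2)); apply: lemxD ENE.
have pE2 : lemx (1%:M - E) 1%:M by rewrite /lemx opprB addrC subrK.
apply: (lemx_trans _ (lemx_sqr pE1 pE2)).
by have := lemx_conj (1%:M - E) N1; rewrite hE1 mulmx1; apply.
Qed.

(** A gentle measurement estimate: 1 - P Q P = (1 - P) + P (1 - Q) P, and splitting P = 1 + (P - 1)
    in the last term costs 2 (1 - Q) + 2 (1 - P). *)
Lemma sandwich_test P Q : adj P = P -> P *m P = P -> adj Q = Q -> Q *m Q = Q ->
  [/\ psdmx (P *m Q *m P), lemx (P *m Q *m P) 1%:M &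
   lemx (1%:M - P *m Q *m P) (3%:C *: (1%:M - P) + 2%:C *: (1%:M - Q))].
Proof.
move=> hP PP hQ QQ.
have projC (X : 'M[C]_n) : adj X = X -> X *m X = X -> psdmx X /\ psdmx (1%:M - X).
  move=> hX XX; split; first by rewrite -XX -{1}hX; exact: psdmx_gram.
  have -> : 1%:M - X = adj (1%:M - X) *m (1%:M - X).
    rewrite adjmxB adjmx1 hX !(mulmxBl, mulmxBr, mulmx1, mul1mx, mulNmx, mulmxN) XX subrr subr0 //.
  exact: psdmx_gram.
have [pP pP1] := projC _ hP PP; have [pQ pQ1] := projC _ hQ QQ.
have pE : psdmx (P *m Q *m P) by rewrite -{1}hP; exact: psdmx_conj.
have Eq : 1%:M - P *m Q *m P = (1%:M - P) + P *m (1%:M - Q) *m P.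
  rewrite mulmxBr mulmxBl mulmx1 PP; by rewrite addrA subrK.
split; first exact: pE.
  rewrite /lemx Eq; apply: (psdmxD pP1); rewrite -{1}hP; exact: psdmx_conj.
rewrite Eq; have := lemx_mul2 1%:M (P - 1%:M) pQ1.
rewrite addrC subrK hP adjmx1 mul1mx mulmx1 => h.
have hZ : adj (P - 1%:M) = P - 1%:M by rewrite adjmxB hP adjmx1.
have Z1 : lemx (adj (P - 1%:M) *m (1%:M - Q) *m (P - 1%:M)) (1%:M - P).
  have -> : 1%:M - P = adj (P - 1%:M) *m 1%:M *m (P - 1%:M).
    rewrite hZ !(mulmxBl, mulmxBr, mulmx1, mul1mx, mulNmx, mulmxN) PP subrr sub0r opprB.
    by [].
  by apply: lemx_conj; rewrite /lemx opprB addrC subrK.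
have h2 := lemxZ (ler0n R 2) (lemxD (lemx_refl (1%:M - Q)) Z1).
have := lemxD (lemx_refl (1%:M - P)) (lemx_trans h h2).
rewrite /lemx; congr psdmx.
have -> : 3%:C = 3 :> C by rewrite rmorph_nat.
have -> : 2%:C = 2 :> C by rewrite rmorph_nat.
mx_linear.
Qed.

(** The last clause is Markov's inequality for operators: its trace bounds the rank of 1 - P by tr S
    / a. *)
Lemma spectral_cut S (a : R) : psdmx S -> 0 <= a ->
  exists P, [/\ adj P = P, P *m P = P, lemx (P *m S *m P) a%:C%:M &
    lemx (a%:C *: (1%:M - P)) S].
Proof.
move=> /psd_usp[U [d [uU -> d0]]] a0.
exists (usp U (fun j => (d j <= a)%R%:R)); split.
- exact: adj_usp.
- by rewrite (uspM uU); apply: usp_eq=> j; case: (_ <= _); rewrite ?mulr1 ?mulr0.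
- rewrite -(usp_cst uU a) (uspM uU) (uspM uU) /lemx uspB.
  apply: usp_psd => // j.
  by case: (leP (d j) a) (d0 j) => h h0; rewrite /= ?mul1r ?mul0r ?mulr1 ?mul0r ?subr0 ?subr_ge0.
- rewrite -(usp1 uU) uspB uspZ /lemx uspB; apply: usp_psd => // j.
  case: (leP (d j) a) (d0 j) => h h0; rewrite ?subrr ?subr0 ?mulr0 ?mulr1 ?subr0 // subr_ge0.
  exact: ltW.
Qed.

(** Eigenvalues above b are counted in full; the others contribute at most b times the trace of Q,
    which for a projection is its rank. *)
Lemma Rtr_rank_bound U (d : 'I_n -> R) Q (b : R) : unitary U ->
  (forall j, 0 <= d j) -> 0 <= b -> psdmx Q -> lemx Q 1%:M ->
  Rtr (usp U d *m Q) <= \sum_(j | b < d j) d j + b * Rtr Q.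
Proof.
move=> uU d0 b0 pQ Q1.
pose f j := if b < d j then d j else 0.
have f0 j : 0 <= f j by rewrite /f; case: ifP.
have h : lemx (usp U d) (usp U f + b%:C *: 1%:M).
  rewrite -(usp1 uU) uspZ uspD /lemx uspB; apply: usp_psd => // j /=.
  by rewrite /f mulr1; case: ltP => h; rewrite ?add0r ?subr_ge0 // lerDl.
rewrite RtrC; apply: (le_trans (Rtr_leM pQ h)).
rewrite mulmxDr RtrD -scalemxAr RtrZ mulmx1 lerD2r RtrC.
have := Rtr_leM (usp_psd uU f0) Q1; rewrite mulmx1 => /le_trans; apply.
by rewrite /Rtr (usp_tr uU) [in leRHS]big_mkcond /= lexx.
Qed.

End OperatorInequalities.

(** * Random coding *)

Section RandomCoding.
Variable R : realType.
Local Notation C := R[i].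
Local Notation adj := (@adjmx R _ _).
Local Notation "x %:C" := (real_complex R x) : ring_scope.

Lemma exists_le_mean (I : finType) (q f : I -> R) (b : R) :
  is_distr q -> \sum_i q i * f i <= b -> exists i, f i <= b.
Proof.
move=> [q0 q1] h; apply: contrapT => /forallNP nb.
have qb i : q i * b <= q i * f i.
  by apply: ler_wpM2l => //; have /negP := nb i; rewrite -ltNge => /ltW.
have h2 : \sum_i q i * (f i - b) <= 0.
  rewrite (eq_bigr (fun i => q i * f i - q i * b)); last by move=> i _; rewrite mulrBr.
  by rewrite sumrB -mulr_suml q1 mul1r subr_le0.
have z i : q i = 0.
  have /eqP : \sum_i q i * (f i - b) = 0.
    apply/eqP; rewrite eq_le h2 sumr_ge0 // => k _.
    by rewrite mulrBr subr_ge0.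
  rewrite psumr_eq0; last by move=> k _; rewrite mulrBr subr_ge0.
  move=> /allP/(_ i (mem_index_enum _)); rewrite mulf_eq0 => /orP[/eqP//|].
  by have /negP := nb i; rewrite -ltNge subr_eq0 => /gt_eqF ->.
by move: q1; rewrite big1 // => /esym/eqP; rewrite oner_eq0.
Qed.

Lemma prod_distr (I J : finType) (q : J -> R) : is_distr q ->
  is_distr (fun f : {ffun I -> J} => \prod_i q (f i)).
Proof.
move=> [q0 q1]; split; first by move=> f; apply: prodr_ge0.
by rewrite (sum_ffun_prod (fun _ => q)) big1.
Qed.

(** D m is G^(-1/2) F m G^(-1/2) for G = sum F + e. The multiple e of the identity makes G
    invertible, so no pseudo-inverse is needed, at the price of 4 e in the error. *)
Lemma square_root_measurement N M (F : 'I_M -> 'M[C]_N) (e : R) : 0 < e ->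
  (forall m, psdmx (F m)) -> (forall m, lemx (F m) 1%:M) ->
  exists D : 'I_M -> 'M[C]_N, [/\ forall m, psdmx (D m), lemx (\sum_m D m) 1%:M &
    forall m, lemx (1%:M - D m)
      (2%:C *: (1%:M - F m) + 4%:C *: (\sum_(m' | m' != m) F m' + e%:C%:M))].
Proof.
move=> e0 pF F1; pose G := \sum_m F m + e%:C%:M.
have pe : psdmx (e%:C%:M : 'M[C]_N).
  by rewrite scalar_rC; apply: psdmxZ; [exact: ltW|exact: psdmx1].
have pS : psdmx (\sum_m F m) by apply: psdmx_sum.
have [U [g [uU GE _]]] := psd_usp (psdmxD pS pe).
have ge j : e <= g j.
  rewrite -subr_ge0; move: j; apply: (usp_psd_ge0 uU).
  by rewrite -uspB -GE (usp_cst uU) addrK.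
have g0 j : 0 < g j := lt_le_trans e0 (ge j).
pose T := usp U (Num.sqrt \o g); pose Ti := usp U (fun j => (Num.sqrt (g j))^-1).
have s0 j : Num.sqrt (g j) != 0 by rewrite gt_eqF // sqrtr_gt0.
have hTi : adj Ti = Ti := adj_usp U _.
have TiT : Ti *m T = 1%:M.
  by rewrite (uspM uU) -(usp1 uU); apply: usp_eq=> j /=; rewrite mulVf.
have TT : T *m T = \sum_m F m + e%:C%:M.
  by rewrite GE (uspM uU); apply: usp_eq=> j /=; rewrite -expr2 sqr_sqrtr // ltW.
have pT : psdmx T by apply: (usp_psd uU) => j; rewrite sqrtr_ge0.
have TF m : T *m T - F m = \sum_(m' | m' != m) F m' + e%:C%:M.
  by rewrite TT (bigD1 m) //= -(addrA (F m)) (addrC (F m)) addrK.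
have FT m : lemx (F m) (T *m T).
  by rewrite /lemx TF; apply: (psdmxD _ pe); apply: psdmx_sum => i _; exact: pF.
exists (fun m => Ti *m F m *m Ti); split.
- by move=> m; rewrite -{1}hTi; exact: (psdmx_conj Ti (pF m)).
- rewrite -mulmx_suml -mulmx_sumr /lemx.
  have -> : 1%:M - Ti *m (\sum_m F m) *m Ti = adj Ti *m e%:C%:M *m Ti.
    have -> : \sum_m F m = T *m T - e%:C%:M by rewrite TT addrK.
    have TTTT : Ti *m (T *m T) *m Ti = 1%:M.
      by rewrite mulmxA TiT mul1mx (mulmx1C TiT).
    by rewrite mulmxBr mulmxBl TTTT hTi opprB addrC subrK.
  exact: psdmx_conj.
- move=> m; rewrite -TF.
  exact: (hayashi_nagaoka (pF m) (F1 m) pT hTi TiT (FT m)).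
Qed.

(** The errors of all the channels are summed before averaging over codebooks, so that a single
    codebook is good for every t. The price is the sum over s on the right. *)
Lemma random_coding (A T : finType) N M (q : A -> R) (rho : T -> A -> 'M[C]_N)
    (F : A -> 'M[C]_N) (e : R) : is_distr q -> (0 < M)%N -> 0 < e ->
  (forall t a, density (rho t a)) ->
  (forall a, psdmx (F a)) -> (forall a, lemx (F a) 1%:M) ->
  exists (u : 'I_M -> A) (D : 'I_M -> 'M[C]_N),
    [/\ forall m, psdmx (D m), lemx (\sum_m D m) 1%:M &
    forall t, M%:R^-1 * \sum_m Rtr (rho t (u m) *m (1%:M - D m)) <=
     \sum_s (2 * \sum_a q a * Rtr (rho s a *m (1%:M - F a)) +
        4 * M%:R * \sum_a q a * Rtr ((\sum_b (q b)%:C *: rho s b) *m F a) + 4 * e)].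
Proof.
move=> dq M0 e0 drho pF F1; have [q0 q1] := dq.
have MR : M%:R != 0 :> R by rewrite pnatr_eq0 -lt0n.
(* The error bound of the square-root measurement, written without D: it can be averaged first, and
   the measurement is built once the codebook is fixed. *)
pose err t (u : {ffun 'I_M -> A}) : R := M%:R^-1 * \sum_m
  (2 * Rtr (rho t (u m) *m (1%:M - F (u m))) +
   4 * \sum_(m' | m' != m) Rtr (rho t (u m) *m F (u m')) + 4 * e).
have pos t a b : 0 <= Rtr (rho t a *m F b) by apply: Rtr_psdM => //; case: (drho t a).
have err0 t u : 0 <= err t u.
  apply: mulr_ge0; first by rewrite invr_ge0.
  apply: sumr_ge0 => m _.
  have h1 : 0 <= Rtr (rho t (u m) *m (1%:M - F (u m))).
    by apply: Rtr_psdM; [case: (drho t (u m))|exact: F1].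
  have h2 : 0 <= \sum_(m' | m' != m) Rtr (rho t (u m) *m F (u m')).
    by apply: sumr_ge0 => m' _; exact: pos.
  by apply: addr_ge0; [apply: addr_ge0|]; apply: mulr_ge0 => //; exact: ltW.
have mean t : \sum_(u : {ffun 'I_M -> A}) (\prod_m q (u m)) * err t u <=
   2 * \sum_a q a * Rtr (rho t a *m (1%:M - F a)) +
   4 * M%:R * \sum_a q a * Rtr ((\sum_b (q b)%:C *: rho t b) *m F a) + 4 * e.
  have swap : \sum_(u : {ffun 'I_M -> A}) (\prod_m q (u m)) * err t u =
    M%:R^-1 * \sum_m (2 * (\sum_(u : {ffun 'I_M -> A}) (\prod_m q (u m)) *
        Rtr (rho t (u m) *m (1%:M - F (u m)))) +
      4 * (\sum_(m' | m' != m) \sum_(u : {ffun 'I_M -> A}) (\prod_m q (u m)) *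
        Rtr (rho t (u m) *m F (u m'))) + 4 * e).
    rewrite /err; under eq_bigr do rewrite mulrCA mulr_sumr.
    rewrite -mulr_sumr exchange_big /=; congr (_ * _); apply: eq_bigr=> m _.
    under eq_bigr do rewrite !mulrDr.
    rewrite !big_split /=; congr (_ + _ + _).
    - by rewrite mulr_sumr; apply: eq_bigr=> u _; rewrite mulrCA.
    - rewrite exchange_big /= mulr_sumr; apply: eq_bigr=> u _.
      by rewrite mulrCA; congr (_ * _); rewrite mulr_sumr.
    - by rewrite -mulr_suml (sum_ffun_prod (fun _ => q)) big1 ?mul1r.
  rewrite swap; set a1 := \sum_a q a * Rtr (rho t a *m (1%:M - F a)).
  set a2 := \sum_a q a * _.
  have a20 : 0 <= a2.
    apply: sumr_ge0 => a _; apply: mulr_ge0 => //; apply: Rtr_psdM => //.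
    by case: (mixture_density dq (drho t)).
  (* Distinct codewords are independent, so the state sent averages to the mixture while the test of
     the other codeword is kept. *)
  have cross m m' : m' != m -> \sum_(u : {ffun 'I_M -> A}) (\prod_m q (u m)) *
        Rtr (rho t (u m) *m F (u m')) = a2.
    move=> mm'; rewrite (sum_ffun_marginal2 (fun a b => Rtr (rho t a *m F b)) _ (w := fun _ => q)) // 1?eq_sym //.
    rewrite exchange_big /=; apply: eq_bigr=> b _.
    rewrite mulmx_suml Rtr_sum mulr_sumr; apply: eq_bigr=> a _.
    by rewrite -scalemxAl RtrZ; ring.
  rewrite (eq_bigr (fun m : 'I_M => 2 * a1 + 4 * (\sum_(m' | m' != m) a2) + 4 * e)); last first.
    move=> m _; congr (_ * _ + _ * _ + _); last by apply: eq_bigr=> m' /cross ->.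
    by rewrite (sum_ffun_marginal m (fun a => Rtr (rho t a *m (1%:M - F a))) (w := fun _ => q)).
  apply: (@le_trans _ _ (M%:R^-1 * \sum_(m < M) (2 * a1 + 4 * M%:R * a2 + 4 * e))).
    rewrite ler_wpM2l ?invr_ge0 //; apply: ler_sum => m _.
    rewrite lerD2r lerD2l -mulrA ler_wpM2l // [leRHS](_ : _ = \sum_(m' < M) a2).
      by rewrite [leRHS](bigD1 m) //= lerDr.
    by rewrite sumr_const card_ord mulr_natl.
  by rewrite sumr_const card_ord -[X in _ * X]mulr_natl mulKf.
have tot : \sum_(u : {ffun 'I_M -> A}) (\prod_m q (u m)) * (\sum_t err t u) <=
  \sum_s (2 * \sum_a q a * Rtr (rho s a *m (1%:M - F a)) +
        4 * M%:R * \sum_a q a * Rtr ((\sum_b (q b)%:C *: rho s b) *m F a) + 4 * e).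
  under eq_bigr do rewrite mulr_sumr.
  by rewrite exchange_big /=; apply: ler_sum => t _; exact: mean.
have [u hu] := exists_le_mean (prod_distr 'I_M dq) tot.
have [D [pD D1 hD]] := square_root_measurement e0 (fun m => pF (u m)) (fun m => F1 (u m)).
exists u, D; split=> // t; apply: le_trans hu.
rewrite (bigD1 t) //= -[leLHS]addr0 lerD ?sumr_ge0 //.
rewrite ler_wpM2l ?invr_ge0 //; apply: ler_sum => m _.
have [pr tr1] := drho t (u m).
apply: (le_trans (Rtr_leM pr (hD m))).
rewrite (mulmxDr _ (2%:C *: _) (4%:C *: _)) RtrD -!scalemxAr !RtrZ (mulmxDr _ (\sum_(m' | m' != m) _)) RtrD.
rewrite mulmx_sumr Rtr_sum scalar_rC -scalemxAr RtrZ mulmx1.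
by rewrite (Rtr_density (drho t _)) mulr1 mulrDr addrA.
Qed.

End RandomCoding.

(** * Scalar estimates and tail bounds *)

Section ScalarEstimates.
Variable R : realType.
Implicit Types a b c s x y : R.

Lemma ln_le_sub1 x : 0 < x -> ln x <= x - 1.
Proof.
move=> x0; have := @le_ln1Dx R (x - 1); have -> : 1 + (x - 1) = x by ring.
by apply; lra.
Qed.

Lemma expR_le_quad y : expR y <= 1 + y + y ^+ 2 * expR `|y|.
Proof.
have h : expR y - 1 <= y * expR y.
  have := expR_ge1Dx (- y); rewrite expRN.
  have e0 := expR_gt0 y; rewrite -(ler_pM2r e0) mulVf ?gt_eqF //; lra.
have [y0|y0] := leP 0 y.
  rewrite ger0_norm //; nra.
rewrite ltr0_norm //; have := expR_ge1Dx y; have : 1 <= expR (- y) by rewrite -expR0 ler_expR; lra.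
nra.
Qed.

Lemma xlnx_ge a : 0 <= a -> a - 1 <= a * ln a.
Proof.
rewrite le_eqVlt => /predU1P[<-|a0]; first by rewrite mul0r; lra.
have := ln_le_sub1 (x := a^-1); rewrite invr_gt0 => /(_ a0); rewrite lnV //.
move=> h; rewrite -subr_ge0.
have := mulr_ge0 (ltW a0) (_ : 0 <= a^-1 - 1 + ln a); rewrite mulrDr mulrBr mulfV ?gt_eqF //.
by move=> /(_ _); lra.
Qed.

(** Uniform in a, so that later exponents ignore small eigenvalues. With a = b^4 the quadratic
    remainder is at most s^2 (ln a)^2 b^2 = 16 s^2 (b ln b)^2, because |s| <= 1/2 bounds the
    exponential by b^(-2), and |b ln b| <= 1. *)
Lemma moment_bound a s : 0 < a -> a <= 1 -> `|s| <= 1 / 2 ->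
  a * expR (s * ln a) <= a + s * (a * ln a) + 16 * s ^+ 2.
Proof.
move=> a0 a1 hs; have la : ln a <= 0 by exact: ln_le0.
have := expR_le_quad (s * ln a); rewrite -(ler_pM2l a0) => /le_trans; apply.
rewrite !mulrDr mulr1 (mulrCA a s) lerD2l.
pose b := expR (ln a / 4).
have bb : b ^+ 4 = a by rewrite -expRM_natl mulrC divfK ?lnK ?posrE // pnatr_eq0.
have b0 : 0 < b by exact: expR_gt0.
have lb : ln a = 4 * ln b by rewrite expRK mulrC divfK // pnatr_eq0.
have b1 : b <= 1 by rewrite -expR0 ler_expR; lra.
have e1 : expR `|s * ln a| <= expR (- (ln a / 2)).
  rewrite ler_expR normrM (ler0_norm la); nra.
have e2 : a * expR (- (ln a / 2)) = b ^+ 2.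
  rewrite -[X in X * _](lnK (x := a)) ?posrE // -expRD /b -expRM_natl; congr expR; lra.
have e3 : a * expR `|s * ln a| <= b ^+ 2 by rewrite -e2 ler_pM2l.
have bl : (b * ln b) ^+ 2 <= 1.
  have := xlnx_ge (ltW b0); have : b * ln b <= 0 by rewrite pmulr_rle0 // ln_le0.
  nra.
have -> : a * ((s * ln a) ^+ 2 * expR `|s * ln a|) =
  s ^+ 2 * (ln a) ^+ 2 * (a * expR `|s * ln a|) by ring.
apply: (@le_trans _ _ (s ^+ 2 * (ln a) ^+ 2 * b ^+ 2)).
  by rewrite ler_wpM2l // mulr_ge0 // sqr_ge0.
rewrite lb; have -> : s ^+ 2 * (4 * ln b) ^+ 2 * b ^+ 2 = 16 * s ^+ 2 * (b * ln b) ^+ 2 by ring.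
by rewrite ler_piMr // mulr_ge0 // sqr_ge0.
Qed.

(** Markov's inequality for the log-likelihood ratio: the left side vanishes unless a / b exceeds c.
    The summand b keeps the right side nonnegative, since a ln (a / b) >= a - b. *)
Lemma relative_entropy_pointwise a b c : 0 <= a -> 0 < b -> 1 <= c ->
  ln c * (a - Num.min a (c * b)) <= a * ln a - a * ln b + b.
Proof.
move=> a0 b0 c1; have lc : 0 <= ln c by exact: ln_ge0.
move: a0; rewrite le_eqVlt => /predU1P[<-|a0].
  have -> : Num.min 0 (c * b) = 0 by apply/min_idPl; apply: mulr_ge0; lra.
  rewrite subrr mulr0; lra.
have key : a - b <= a * ln a - a * ln b.
  have := ln_le_sub1 (divr_gt0 b0 a0); rewrite ln_div ?posrE //.
  rewrite -(ler_pM2l a0) mulrBr (mulrBr a (b / a)) mulr1 (mulrC a (b / a)) divfK ?gt_eqF //; lra.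
case: (leP a (c * b)) => h; first by rewrite subrr mulr0; lra.
have : ln c + ln b <= ln a.
  rewrite -lnM ?posrE //; last by lra.
  by rewrite ler_ln ?posrE // ?ltW //; apply: mulr_gt0 => //; lra.
have cb : 0 <= c * b by apply: mulr_ge0; lra.
move=> h2; have : a * (ln c + ln b) <= a * ln a by rewrite ler_pM2l.
have := mulr_ge0 lc cb; lra.
Qed.

(* Entropy in nats; zero eigenvalues contribute nothing since [ln 0 = 0] in the library. *)
Definition Hs (J : finType) (d : J -> R) : R := - \sum_j d j * ln (d j).

(* The spectrum of (rho + eta 1)/(1 + n eta), for d the spectrum of the n x n state rho. *)
Definition smoothed n (d : 'I_n -> R) (eta : R) (j : 'I_n) : R :=
  (d j + eta) / (1 + n%:R * eta).

Section Perturbation.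
Variables (n : nat) (d : 'I_n -> R) (eta : R).
Hypotheses (d0 : forall j, 0 <= d j) (d1 : \sum_j d j = 1).
Hypotheses (e0 : 0 < eta) (e1 : eta <= 1).
Local Notation N := (n%:R : R).
Local Notation d' := (smoothed d eta).

Lemma distr_le1 j : d j <= 1.
Proof. by rewrite -d1 (bigD1 j) //= lerDl sumr_ge0. Qed.

Lemma Hs_ge0 : 0 <= Hs d.
Proof.
rewrite /Hs oppr_ge0; apply: sumr_le0 => j _.
have := d0 j; rewrite le_eqVlt => /predU1P[<-|dj]; first by rewrite mul0r.
by rewrite pmulr_rle0 // ln_le0 // distr_le1.
Qed.

Lemma Hs_le : Hs d <= N.
Proof.
rewrite /Hs -sumrN; apply: (@le_trans _ _ (\sum_(j < n) 1)).
  by apply: ler_sum => j _; have := xlnx_ge (d0 j); have := d0 j; lra.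
by rewrite sumr_const card_ord.
Qed.

Lemma sum_smoothed : \sum_j d' j = 1.
Proof.
have h : 0 < 1 + N * eta by rewrite ltr_wpDr // mulr_ge0 ?ler0n // ltW.
rewrite /smoothed -mulr_suml big_split /= d1 sumr_const card_ord -[eta *+ n]mulr_natl.
by rewrite divff // gt_eqF.
Qed.

Lemma Hs_smoothedE : Hs d' =
  - (\sum_j (d j + eta) * ln (d j + eta)) / (1 + N * eta) + ln (1 + N * eta).
Proof.
have h : 0 < 1 + N * eta by rewrite ltr_wpDr // mulr_ge0 ?ler0n // ltW.
rewrite /Hs (eq_bigr (fun j => (d j + eta) * ln (d j + eta) / (1 + N * eta) - d' j * ln (1 + N * eta))).
  by rewrite sumrB -mulr_suml -[X in _ - X]mulr_suml sum_smoothed; ring.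
move=> j _; rewrite /smoothed ln_div ?posrE //; last by rewrite ltr_wpDl.
by ring.
Qed.

(** -x ln x is subadditive, which bounds the numerator by a nonnegative quantity; dividing by 1 + n
    eta does not increase it, and ln (1 + n eta) <= n eta. *)
Lemma Hs_smoothed_le : Hs d' <= Hs d + N * (- (eta * ln eta)) + N * eta.
Proof.
have Ne : 0 <= N * eta by rewrite mulr_ge0 ?ler0n // ltW.
rewrite Hs_smoothedE; apply: lerD; last first.
  by apply: (le_trans (ln_le_sub1 _)); lra.
have K : - (\sum_j (d j + eta) * ln (d j + eta)) <= Hs d + N * (- (eta * ln eta)).
  have -> : N * (- (eta * ln eta)) = \sum_(j < n) - (eta * ln eta).
    by rewrite sumr_const card_ord mulr_natl.
  rewrite /Hs -!sumrN -big_split /=; apply: ler_sum => j _.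
  have h2 : eta * ln eta <= eta * ln (d j + eta).
    rewrite ler_pM2l // ler_ln ?posrE //; last by rewrite ltr_wpDl.
    by rewrite lerDr.
  have h1 : d j * ln (d j) <= d j * ln (d j + eta).
    have := d0 j; rewrite le_eqVlt => /predU1P[<-|dj]; first by rewrite !mul0r.
    by rewrite ler_pM2l // ler_ln ?posrE ?lerDl ?ltW // addr_gt0.
  rewrite mulrDl; lra.
have le0 : 0 <= - (eta * ln eta) by rewrite oppr_ge0 pmulr_rle0 // ln_le0.
have g0 : 0 <= Hs d + N * (- (eta * ln eta)).
  by rewrite addr_ge0 ?Hs_ge0 // mulr_ge0 // ler0n.
rewrite ler_pdivrMr; last by lra.
apply: (le_trans K); rewrite ler_peMr //; lra.
Qed.

(** Adding eta costs at most 2 eta per eigenvalue, and dividing by 1 + n eta at most n (n eta),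
    because the entropy is at most n. *)
Lemma Hs_smoothed_ge : Hs d - N * (N * eta) - 2 * (N * eta) <= Hs d'.
Proof.
have Ne : 0 <= N * eta by rewrite mulr_ge0 ?ler0n // ltW.
have h : 0 < 1 + N * eta by lra.
have K : Hs d - 2 * (N * eta) <= - (\sum_j (d j + eta) * ln (d j + eta)).
  have -> : 2 * (N * eta) = \sum_(j < n) 2 * eta.
    by rewrite sumr_const card_ord -[RHS]mulr_natl; ring.
  rewrite /Hs -!sumrN -big_split /=; apply: ler_sum => j _.
  have h1 : d j * ln (d j + eta) - d j * ln (d j) <= eta.
    have := d0 j; rewrite le_eqVlt => /predU1P[<-|dj]; first by rewrite !mul0r subrr ltW.
    have dje : 0 < d j + eta by rewrite addr_gt0.
    have := ln_le_sub1 (divr_gt0 dje dj); rewrite ln_div ?posrE //.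
    rewrite -(ler_pM2l dj) mulrBr (mulrBr _ (_ / _)) (mulrC _ (_ / _)) divfK ?gt_eqF //; lra.
  have h2 : eta * ln (d j + eta) <= eta.
    have h3 : ln (d j + eta) <= 1.
      have dje : 0 < d j + eta by rewrite ltr_wpDl.
      by apply: (le_trans (ln_le_sub1 dje)); rewrite lerBlDr lerD ?distr_le1.
    by rewrite ger_pMr.
  rewrite mulrDl; lra.
rewrite Hs_smoothedE; have l0 : 0 <= ln (1 + N * eta) by apply: ln_ge0; lra.
apply: (@le_trans _ _ ((Hs d - 2 * (N * eta)) / (1 + N * eta))).
  rewrite ler_pdivlMr //; have := Hs_le; have := Hs_ge0.
  have N0 : 0 <= N by rewrite ler0n.
  have h1 := mulr_ge0 (_ : 0 <= N - Hs d) Ne.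
  move: h1; rewrite subr_ge0 => h1 Hp Hn; have {}h1 := h1 Hn.
  have h2 := mulr_ge0 (mulr_ge0 N0 Ne) Ne; have h3 := mulr_ge0 Ne Ne.
  lra.
by rewrite -[leLHS]addr0 lerD // ler_wpM2r // invr_ge0 ltW.
Qed.

End Perturbation.

(** For eta = t^2 the inequality t ln t >= t - 1 gives -eta ln eta <= 2 t. All requirements then
    become linear in t, and the denominator of t dominates their coefficients. *)
Lemma smoothing_parameter (n : nat) (e g : R) : 0 < e -> 0 < g ->
  exists eta : R, [/\ 0 < eta, eta <= 1, n%:R * eta <= g,
    n%:R * (- (eta * ln eta)) + n%:R * eta <= e &
    n%:R * (n%:R * eta) + 2 * (n%:R * eta) <= e].
Proof.
move=> e0 g0; have N0 : 0 <= n%:R :> R by rewrite ler0n.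
move: (n%:R : R) N0 => N N0.
have m0 : 0 < Num.min e g by rewrite lt_min e0.
have me : Num.min e g <= e by rewrite ge_min lexx.
have mg : Num.min e g <= g by rewrite ge_min lexx orbT.
move: (Num.min e g) m0 me mg => m m0 me mg.
pose t := m / (m + 3 * N + N * N + 1).
have D0 : 0 < m + 3 * N + N * N + 1 by nra.
have t0 : 0 < t by apply: divr_gt0.
have tE : t * (m + 3 * N + N * N + 1) = m by rewrite /t divfK // gt_eqF.
have t1 : t <= 1 by rewrite /t ler_pdivrMr //; nra.


have tt : t ^+ 2 <= t by nra.
have NN : 0 <= N * N by nra.
have lt : - (t ^+ 2 * ln (t ^+ 2)) <= 2 * t.
  have := xlnx_ge (ltW t0); rewrite lnXn // -mulr_natl; nra.
clearbody t; clear D0; exists (t ^+ 2); split.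
- exact: exprn_gt0.
- nra.
- nra.
- have := ler_wpM2l N0 lt; have := ler_wpM2l N0 tt; nra.
- have := ler_wpM2l N0 tt; have := ler_wpM2l NN tt; nra.
Qed.

End ScalarEstimates.

(** * Chernoff bounds for product spectra *)

Section Tails.
Variable R : realType.
Implicit Types (n l : nat) (s delta : R).

Lemma prod_expR_ln l (v : 'I_l -> R) : (forall k, 0 < v k) ->
  \prod_k v k = expR (\sum_k ln (v k)).
Proof. by move=> v0; rewrite expR_sum; apply: eq_bigr=> k _; rewrite lnK // posrE. Qed.

Lemma moment_sum n (a : 'I_n -> R) s : (forall j, 0 < a j) -> \sum_j a j = 1 ->
  `|s| <= 1 / 2 ->
  \sum_j a j * expR (s * ln (a j)) <= 1 + (- (s * Hs a) + 16 * n%:R * s ^+ 2).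
Proof.
move=> a0 a1 hs.
have -> : 1 + (- (s * Hs a) + 16 * n%:R * s ^+ 2) =
    \sum_j (a j + s * (a j * ln (a j)) + 16 * s ^+ 2).
  rewrite !big_split /= a1 -mulr_sumr sumr_const card_ord /Hs.
  rewrite -[(16 * s ^+ 2) *+ n]mulr_natl; ring.
apply: ler_sum => j _; apply: moment_bound => //.
by apply: distr_le1 => // i; exact: ltW.
Qed.

Lemma mixture_moment (X : finType) n (p : X -> R) (a : X -> 'I_n -> R) s :
  is_distr p -> (forall x j, 0 < a x j) -> (forall x, \sum_j a x j = 1) ->
  `|s| <= 1 / 2 ->
  \sum_x p x * (\sum_j a x j * expR (s * ln (a x j))) <=
  expR (- (s * \sum_x p x * Hs (a x)) + 16 * n%:R * s ^+ 2).
Proof.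
move=> [p0 p1] a0 a1 hs; apply: le_trans (expR_ge1Dx _).
have -> : 1 + (- (s * \sum_x p x * Hs (a x)) + 16 * n%:R * s ^+ 2) =
   \sum_x p x * (1 + (- (s * Hs (a x)) + 16 * n%:R * s ^+ 2)).
  under [RHS]eq_bigr do rewrite !mulrDr mulr1.
  rewrite !big_split /= p1 -mulr_suml p1 mul1r; congr (_ + (_ + _)).
  by rewrite mulr_sumr -sumrN; apply: eq_bigr=> x _; ring.
by apply: ler_sum => x _; apply: ler_wpM2l => //; exact: moment_sum.
Qed.

(** This s maximizes s delta - 16 n s^2; the cap delta <= 16 keeps it in the range of
    [moment_bound]. *)
Lemma exponent_choice n delta : (0 < n)%N -> 0 < delta -> delta <= 16 ->
  let s := delta / (32 * n%:R) in
  [/\ 0 <= s, s <= 1 / 2 & s * delta - 16 * n%:R * s ^+ 2 = delta ^+ 2 / (64 * n%:R)].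
Proof.
move=> n0 d0 d16 s; have N1 : 1 <= n%:R :> R by rewrite ler1n.
have s0 : 0 <= s by rewrite divr_ge0 ?mulr_ge0 // ltW.
split=> //; first by rewrite /s ler_pdivrMr; lra.
by rewrite /s; field; rewrite pnatr_eq0 -lt0n.
Qed.

(** Chernoff's bound: on the range of summation the s-th power of the eigenvalue, divided by that of
    the threshold, is at least 1. With this factor inserted and the restriction dropped, the sum
    factorizes over the positions. *)
Lemma product_lower_tail n l (b : 'I_n -> R) delta : (0 < n)%N ->
  (forall j, 0 < b j) -> \sum_j b j = 1 -> 0 < delta -> delta <= 16 ->
  \sum_(i < n ^ l | expR (- (l%:R * (Hs b - delta))) < \prod_(k < l) b (digit i k))
     \prod_(k < l) b (digit i k) <= expR (- (l%:R * (delta ^+ 2 / (64 * n%:R)))).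
Proof.
move=> n0 b0 b1 d0 d16; have [] := exponent_choice n0 d0 d16.
set s := delta / _ => s0 s1 sE.
apply: (@le_trans _ _ (\sum_(i < n ^ l) (\prod_(k < l) (b (digit i k) * expR (s * ln (b (digit i k)))))
    * expR (s * (l%:R * (Hs b - delta))))).
  rewrite big_mkcond /=; apply: ler_sum => i _.
  have P0 : 0 <= \prod_(k < l) b (digit i k) by apply: prodr_ge0 => k _; exact: ltW.
  case: ifPn => h; last first.
    by rewrite mulr_ge0 ?expR_ge0 // prodr_ge0 // => k _; rewrite mulr_ge0 ?expR_ge0 // ltW.
  rewrite big_split /= -expR_sum -mulrA -expRD; apply: ler_peMr => //.
  rewrite -[leLHS]expR0 ler_expR -mulr_sumr -mulrDr; apply: mulr_ge0 => //.
  move: h; rewrite (prod_expR_ln (v := fun k => b (digit i k))) // ltr_expR => h.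
  by rewrite -lerBlDr sub0r ltW.
rewrite -mulr_suml (sum_digit (fun f : {ffun 'I_l -> 'I_n} => \prod_k (b (f k) * expR (s * ln (b (f k)))))).
rewrite (sum_ffun_prod (fun _ j => b j * expR (s * ln (b j)))) prodr_const card_ord.
have hm := moment_sum b0 b1 (_ : `|s| <= 1 / 2); rewrite ger0_norm // in hm.
have {}hm := le_trans (hm s1) (expR_ge1Dx _).
apply: (@le_trans _ _ (expR (- (s * Hs b) + 16 * n%:R * s ^+ 2) ^+ l * expR (s * (l%:R * (Hs b - delta))))).
  rewrite ler_wpM2r ?expR_ge0 // lerXn2r // nnegrE ?expR_ge0 //.
  by apply: sumr_ge0 => j _; rewrite mulr_ge0 ?expR_ge0 // ltW.
rewrite -expRM_natl -expRD ler_expR -sE le_eqVlt; apply/orP; left; apply/eqP; ring.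
Qed.

(** Averaging over codewords makes the pairs of letter and eigenvalue index independent and
    identically distributed, so codewords need not be restricted to typical ones. *)
Lemma product_upper_tail (X : finType) n l (p : X -> R) (a : X -> 'I_n -> R) delta :
  (0 < n)%N -> is_distr p ->
  (forall x j, 0 < a x j) -> (forall x, \sum_j a x j = 1) -> 0 < delta -> delta <= 16 ->
  \sum_(x : {ffun 'I_l -> X}) (\prod_k p (x k)) *
    (\sum_(i < n ^ l | \prod_k a (x k) (digit i k) <
          expR (- (l%:R * (\sum_x p x * Hs (a x) + delta))))
     \prod_k a (x k) (digit i k)) <= expR (- (l%:R * (delta ^+ 2 / (64 * n%:R)))).
Proof.
move=> n0 dp a0 a1 d0 d16; have [] := exponent_choice n0 d0 d16.
set s := delta / _ => s0 s1 sE; set H := \sum_x p x * _.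
have [p0 p1] := dp.
have ns : `|- s| <= 1 / 2 by rewrite normrN ger0_norm.
pose g x := \sum_j a x j * expR (- s * ln (a x j)).
apply: (@le_trans _ _ (\sum_(x : {ffun 'I_l -> X}) (\prod_k p (x k)) *
    ((\prod_k g (x k)) * expR (- s * (l%:R * (H + delta)))))).
  apply: ler_sum => x _; apply: ler_wpM2l; first by apply: prodr_ge0.
  apply: (@le_trans _ _ (\sum_(i < n ^ l) (\prod_k (a (x k) (digit i k) * expR (- s * ln (a (x k) (digit i k)))))
    * expR (- s * (l%:R * (H + delta))))).
    rewrite big_mkcond /=; apply: ler_sum => i _.
    have P0 : 0 <= \prod_(k < l) a (x k) (digit i k) by apply: prodr_ge0 => k _; exact: ltW.
    case: ifPn => h; last first.
      by rewrite mulr_ge0 ?expR_ge0 // prodr_ge0 // => k _; rewrite mulr_ge0 ?expR_ge0 // ltW.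
    rewrite big_split /= -expR_sum -mulrA -expRD; apply: ler_peMr => //.
    rewrite -[leLHS]expR0 ler_expR -mulr_sumr -mulrDr mulNr -mulrN; apply: mulr_ge0 => //.
    move: h; rewrite (prod_expR_ln (v := fun k => a (x k) (digit i k))) // ltr_expR => h.
    by rewrite oppr_ge0 -lerBrDr sub0r ltW.
  rewrite -mulr_suml (sum_digit (fun f : {ffun 'I_l -> 'I_n} =>
     \prod_k (a (x k) (f k) * expR (- s * ln (a (x k) (f k)))))).
  by rewrite (sum_ffun_prod (fun k j => a (x k) j * expR (- s * ln (a (x k) j)))).
under eq_bigr do rewrite mulrA -big_split /=.
rewrite -mulr_suml (sum_ffun_prod (fun _ x => p x * g x)) prodr_const card_ord.
have hm := mixture_moment dp a0 a1 ns; rewrite -/H in hm.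
apply: (@le_trans _ _ (expR (- (- s * H) + 16 * n%:R * (- s) ^+ 2) ^+ l * expR (- s * (l%:R * (H + delta))))).
  rewrite ler_wpM2r ?expR_ge0 // lerXn2r // nnegrE ?expR_ge0 //.
  apply: sumr_ge0 => x _; rewrite mulr_ge0 // sumr_ge0 // => j _.
  by rewrite mulr_ge0 ?expR_ge0 // ltW.
rewrite -expRM_natl -expRD ler_expR -sE le_eqVlt; apply/orP; left; apply/eqP; ring.
Qed.

End Tails.

(** * Direct part *)

Section DirectPart.
Variable R : realType.
Local Notation C := R[i].
Local Notation adj := (@adjmx R _ _).
Local Notation "x %:C" := (real_complex R x) : ring_scope.

Lemma usp_density n (U : 'M[C]_n) d : unitary U -> (forall j, 0 <= d j) ->
  \sum_j d j = 1 -> density (usp U d).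
Proof. by move=> uU d0 d1; split; [exact: usp_psd|rewrite usp_tr // d1]. Qed.

Lemma lemx_Rtr n (A B : 'M[C]_n) : lemx A B -> Rtr A <= Rtr B.
Proof. by move=> AB; rewrite -subr_ge0 -RtrB; exact: Rtr_psd. Qed.

(** Codewords are functions here, not tuples, so that averages over random codewords factorize. *)
Definition codestate (X : finType) n l (W : X -> 'M[C]_n) (x : {ffun 'I_l -> X}) :=
  tp (fun k => W (x k)).

Section TypicalTest.
Variables (X : finType) (n l : nat) (p : X -> R).
Variables (V : X -> 'M[C]_n) (a : X -> 'I_n -> R) (U : 'M[C]_n) (b : 'I_n -> R).
Variables (delta : R) (tau : 'M[C]_(n ^ l)).
Hypotheses (n0 : (0 < n)%N) (dp : is_distr p).
Hypotheses (uV : forall x, unitary (V x)) (uU : unitary U).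
Hypotheses (a0 : forall x j, 0 < a x j) (a1 : forall x, \sum_j a x j = 1).
Hypotheses (b0 : forall j, 0 < b j) (b1 : \sum_j b j = 1).
Hypothesis mix : \sum_x (p x)%:C *: usp (V x) (a x) = usp U b.
Hypotheses (d0 : 0 < delta) (d16 : delta <= 16).
Hypothesis (ptau : psdmx tau).
Let W x := usp (V x) (a x).
Let L : R := l%:R.
Let gamma := delta ^+ 2 / (64 * n%:R).
Let Hbar := \sum_x p x * Hs (a x).
(** kappa cuts the spectrum of the codeword state, theta that of tau, and beta that of the output
    state. As theta = exp(l delta) beta, the complement of the cut on tau has rank at most tr tau /
    theta, and on it eigenvalues below beta weigh at most tr tau exp(-l delta). *)
Let kappa := expR (- (L * (Hbar + delta))).
Let theta := expR (- (L * (Hs b - 2 * delta))).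
Let beta := expR (- (L * (Hs b - delta))).

Let aa (x : {ffun 'I_l -> X}) (i : 'I_(n ^ l)) := \prod_k a (x k) (digit i k).
Let VV (x : {ffun 'I_l -> X}) := tp (fun k => V (x k)).
Let PP x := usp (VV x) (fun i => (kappa <= aa x i)%R%:R).

Let uVV x : unitary (VV x).
Proof. by apply: tp_unitary. Qed.

Let aa0 x i : 0 <= aa x i.
Proof. by apply: prodr_ge0 => k _; apply: ltW. Qed.

Let stateE x : codestate W x = usp (VV x) (aa x).
Proof. by rewrite /codestate /W tp_usp. Qed.

Let aa1 x : \sum_i aa x i = 1.
Proof.
rewrite (sum_digit (fun f : {ffun 'I_l -> 'I_n} => \prod_k a (x k) (f k))).
by rewrite (sum_ffun_prod (fun k => a (x k))) big1.
Qed.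

Let trPP x : Rtr (PP x) <= kappa^-1.
Proof.
have k0 : 0 < kappa by exact: expR_gt0.
rewrite /PP /Rtr usp_tr //= -(ler_pM2l k0) mulfV ?gt_eqF // -[leRHS](aa1 x) mulr_sumr.
apply: ler_sum => i _; case: (leP kappa (aa x i)) => h; first by rewrite mulr1.
by rewrite mulr0.
Qed.

Let missPP : \sum_(x : {ffun 'I_l -> X}) (\prod_k p (x k)) * Rtr (codestate W x *m (1%:M - PP x)) <=
  expR (- (L * gamma)).
Proof.
apply: le_trans (product_upper_tail l n0 dp a0 a1 d0 d16).
apply: ler_sum => x _; apply: ler_wpM2l.
  by apply: prodr_ge0 => k _; case: dp.
rewrite stateE /PP -(usp1 (uVV x)) uspB uspM // /Rtr usp_tr //= [leRHS]big_mkcond /=.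
apply: ler_sum => i _; rewrite -/(aa x i) -/L -/Hbar -/kappa.
by case: (leP kappa (aa x i)) => h; rewrite ?subrr ?subr0 ?mulr0 ?mulr1.
Qed.

(* The cut Q is taken on tau, which need not commute with the output state of this channel;
   [Rtr_rank_bound] shows that the small rank of its complement makes it harmless. *)
Lemma typical_test : exists E : {ffun 'I_l -> X} -> 'M[C]_(n ^ l),
  [/\ forall x, psdmx (E x), forall x, lemx (E x) 1%:M,
   forall x, Rtr (tau *m E x) <= expR (- (L * (Hs b - Hbar - 3 * delta))) &
   \sum_(x : {ffun 'I_l -> X}) (\prod_k p (x k)) * Rtr (codestate W x *m (1%:M - E x)) <=
     5 * expR (- (L * gamma)) + 3 * (Rtr tau * expR (- (L * delta)))].
Proof.
have th0 : 0 < theta by exact: expR_gt0.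
have be0 : 0 < beta by exact: expR_gt0.
have [Q [hQ QQ Qtau Qrank]] := spectral_cut ptau (ltW th0).
have hP x : adj (PP x) = PP x by exact: adj_usp.
have P2 x : PP x *m PP x = PP x.
  by rewrite /PP (uspM (uVV x)); apply: usp_eq=> i; case: (_ <= _); rewrite ?mulr1 ?mulr0.
have pP x : psdmx (PP x) by apply: (usp_psd (uVV x)) => i; exact: ler0n.
have S x := sandwich_test hQ QQ (hP x) (P2 x).
exists (fun x => Q *m PP x *m Q); split.
- by move=> x; case: (S x).
- by move=> x; case: (S x).
- move=> x.
  have -> : Rtr (tau *m (Q *m PP x *m Q)) = Rtr (PP x *m (Q *m tau *m Q)).
    by rewrite (RtrC tau) -(mulmxA (Q *m PP x)) -(mulmxA Q) (RtrC Q) -(mulmxA (PP x)).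
  apply: (le_trans (Rtr_leM (pP x) Qtau)).
  rewrite scalar_rC -scalemxAr RtrZ mulmx1.
  (* At most 1 / kappa eigenvalues reach kappa. The loss of 3 delta is 2 delta from theta and delta
     from kappa. *)
  apply: (@le_trans _ _ (theta * kappa^-1)).
    by apply: ler_wpM2l; [exact: ltW|exact: trPP].
  rewrite -expRN -expRD ler_expR le_eqVlt; apply/orP; left; apply/eqP; ring.
have pQ1 : psdmx (1%:M - Q).
  have -> : 1%:M - Q = adj (1%:M - Q) *m (1%:M - Q).
    by rewrite adjmxB adjmx1 hQ !(mulmxBl, mulmxBr, mulmx1, mul1mx) QQ subrr subr0.
  exact: psdmx_gram.
have pQ : psdmx Q by rewrite -QQ -{1}hQ; exact: psdmx_gram.
have Q1 : lemx (1%:M - Q) 1%:M by rewrite /lemx opprB addrC subrK.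
have pst (x : {ffun 'I_l -> X}) : psdmx (codestate W x).
  by rewrite stateE; apply: (usp_psd (uVV x)) => i; exact: aa0.
have step x : Rtr (codestate W x *m (1%:M - Q *m PP x *m Q)) <=
    3 * Rtr (codestate W x *m (1%:M - Q)) + 2 * Rtr (codestate W x *m (1%:M - PP x)).
  have [_ _ h] := S x.
  by have := Rtr_leM (pst x) h; rewrite (mulmxDr _ (3%:C *: _)) RtrD -!scalemxAr !RtrZ.
have p0 x : 0 <= \prod_(k < l) p ((x : {ffun 'I_l -> X}) k).
  by apply: prodr_ge0 => k _; case: dp.
apply: (@le_trans _ _ (\sum_(x : {ffun 'I_l -> X}) (\prod_k p (x k)) *
   (3 * Rtr (codestate W x *m (1%:M - Q)) + 2 * Rtr (codestate W x *m (1%:M - PP x))))).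
  by apply: ler_sum => x _; apply: ler_wpM2l.
have -> : \sum_(x : {ffun 'I_l -> X}) (\prod_k p (x k)) *
   (3 * Rtr (codestate W x *m (1%:M - Q)) + 2 * Rtr (codestate W x *m (1%:M - PP x))) =
   3 * Rtr (tp (fun _ : 'I_l => usp U b) *m (1%:M - Q)) +
   2 * \sum_(x : {ffun 'I_l -> X}) (\prod_k p (x k)) * Rtr (codestate W x *m (1%:M - PP x)).
  rewrite -mix -tp_mix mulmx_suml Rtr_sum !mulr_sumr -big_split /=.
  by apply: eq_bigr=> x _; rewrite -scalemxAl RtrZ /codestate /W; ring.
have miss := missPP.
have outside : Rtr (tp (fun _ : 'I_l => usp U b) *m (1%:M - Q)) <=
    expR (- (L * gamma)) + Rtr tau * expR (- (L * delta)).
  rewrite tp_usp; apply: (le_trans (Rtr_rank_bound (tp_unitary (fun=> uU)) _ (ltW be0) pQ1 Q1)).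
    by move=> i; apply: prodr_ge0 => k _; exact: ltW.
  apply: lerD; first exact: (product_lower_tail l n0 b0 b1 d0 d16).
  have := lemx_Rtr Qrank; rewrite RtrZ => h.
  have -> : beta = expR (- (L * delta)) * theta.
    rewrite -expRD; congr expR; rewrite /L; ring.
  rewrite -mulrA [leRHS]mulrC; apply: ler_wpM2l => //; exact: expR_ge0.
lra.
Qed.

End TypicalTest.

End DirectPart.

Section CompoundBlock.
Variable R : realType.
Local Notation C := R[i].
Local Notation adj := (@adjmx R _ _).
Local Notation "x %:C" := (real_complex R x) : ring_scope.

(** Of the 5 delta in the rate, 3 are lost in the tests, one in merging them, and one makes the
    error decay. With K = #|T|, each channel contributes 24 + 12 K for rejecting the right codeword,
    8 K for accepting a wrong one and 4 for regularizing the measurement. *)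
Lemma compound_block_code (X T : finType) (n l M : nat) (p : X -> R)
    (V : T -> X -> 'M[C]_n) (a : T -> X -> 'I_n -> R) (U : T -> 'M[C]_n)
    (b : T -> 'I_n -> R) (delta I0 : R) :
  (0 < n)%N -> is_distr p ->
  (forall t x, unitary (V t x)) -> (forall t, unitary (U t)) ->
  (forall t x j, 0 < a t x j) -> (forall t x, \sum_j a t x j = 1) ->
  (forall t j, 0 < b t j) -> (forall t, \sum_j b t j = 1) ->
  (forall t, \sum_x (p x)%:C *: usp (V t x) (a t x) = usp (U t) (b t)) ->
  0 < delta -> delta <= 16 ->
  (forall t, I0 <= Hs (b t) - \sum_x p x * Hs (a t x)) ->
  (0 < M)%N -> M%:R <= 2 * expR (l%:R * (I0 - 5 * delta)) ->
  exists (u : 'I_M -> {ffun 'I_l -> X}) (D : 'I_M -> 'M[C]_(n ^ l)),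
    [/\ forall m, psdmx (D m), lemx (\sum_m D m) 1%:M &
    forall t, M%:R^-1 * \sum_m
        Rtr (codestate (fun x => usp (V t x) (a t x)) (u m) *m (1%:M - D m)) <=
      #|T|%:R * (28 + 20 * #|T|%:R) * expR (- (l%:R * (delta ^+ 2 / (64 * n%:R))))].
Proof.
move=> n0 dp uV uU a0 a1 b0 b1 mix d0 d16 hI M0 hM.
set gamma := delta ^+ 2 / _; set K : R := #|T|%:R.
have K0 : 0 <= K by exact: ler0n.
pose W t x := usp (V t x) (a t x).
pose sig t := tp (fun _ : 'I_l => usp (U t) (b t)).
have dW t x : density (W t x) by apply: usp_density => // j; exact: ltW.
have dst t (x : {ffun 'I_l -> X}) : density (codestate (W t) x).
  by apply: tp_density => k; exact: dW.
have psig t : psdmx (sig t).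
  by apply: tp_psd => k; apply: (usp_psd (uU t)) => j; exact: ltW.
pose tau := \sum_t sig t.
have ptau : psdmx tau by apply: psdmx_sum => t _; exact: psig.
have trtau : Rtr tau = K.
  rewrite /tau Rtr_sum (eq_bigr (fun=> 1)) ?sumr_const //= => t _.
  by apply: Rtr_density; apply: tp_density => k; apply: usp_density => // j; exact: ltW.
have /(_ _)/cid tests t := typical_test n0 dp (uV t) (uU t) (a0 t) (a1 t) (b0 t) (b1 t)
  (mix t) d0 d16 ptau.
pose E t := sval (tests t).
have pE t x : psdmx (E t x) by rewrite /E; case: (tests t) => /= e [].
have E1 t x : lemx (E t x) 1%:M by rewrite /E; case: (tests t) => /= e [].
have Etau t x : Rtr (tau *m E t x) <= expR (- (l%:R * (I0 - 3 * delta))).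
  rewrite /E; case: (tests t) => /= e [_ _ h _]; apply: (le_trans (h x)).
  rewrite ler_expR lerN2; apply: ler_wpM2l => //; rewrite lerD2r; exact: hI.
have Emiss t : \sum_(x : {ffun 'I_l -> X}) (\prod_k p (x k)) *
     Rtr (codestate (W t) x *m (1%:M - E t x)) <=
     5 * expR (- (l%:R * gamma)) + 3 * (K * expR (- (l%:R * delta))).
  by rewrite /E; case: (tests t) => /= e [_ _ _]; rewrite trtau.
clearbody E; clear tests.
(* Used twice: as the threshold of the merged test and as the regularization of the measurement. *)
pose lam := expR (- (l%:R * delta)).
have lam0 : 0 < lam by exact: expR_gt0.
have pS x : psdmx (\sum_t E t x) by apply: psdmx_sum => t _; exact: pE.
have /(_ _)/cid unions x := union_test (pS x) lam0.
pose F x := sval (unions x).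
have pF x : psdmx (F x) by rewrite /F; case: (unions x) => /= e [].
have F1 x : lemx (F x) 1%:M by rewrite /F; case: (unions x) => /= e [].
have Fle x : lemx (lam%:C *: F x) (\sum_t E t x) by rewrite /F; case: (unions x) => /= e [].
have Fmiss x t : lemx (1%:M - F x) (2%:C *: (1%:M - E t x) + (2 * lam)%:C%:M).
  rewrite /F; case: (unions x) => /= e [_ _ _]; apply; [exact: pE|exact: E1|].
  exact: (lemx_term_sum t (pE ^~ x)).
clearbody F; clear unions.
have dpl := prod_distr 'I_l dp.
have [u [D [pD D1 hD]]] := random_coding dpl M0 lam0 dst pF F1.
exists u, D; split=> // t; apply: (le_trans (hD t)) => {hD}.
have lamg : lam <= expR (- (l%:R * gamma)).
  rewrite ler_expR lerN2; apply: ler_wpM2l => //.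
  rewrite /gamma ler_pdivrMr ?mulr_gt0 ?ltr0n // expr2; apply: ler_wpM2l; first exact: ltW.
  have N1 : 1 <= n%:R :> R by rewrite ler1n.
  by lra.
set G := expR (- (l%:R * gamma)) in Emiss lamg *.
have G0 : 0 <= G by exact: expR_ge0.
have part1 s : \sum_(x : {ffun 'I_l -> X}) (\prod_k p (x k)) *
     Rtr (codestate (W s) x *m (1%:M - F x)) <= (12 + 6 * K) * G.
  apply: (@le_trans _ _ (\sum_(x : {ffun 'I_l -> X}) (\prod_k p (x k)) *
     (2 * Rtr (codestate (W s) x *m (1%:M - E s x)) + 2 * lam))).
    apply: ler_sum => x _; apply: ler_wpM2l; first by case: dpl.
    have [px _] := dst s x.
    have := Rtr_leM px (Fmiss x s); rewrite (mulmxDr _ (2%:C *: _)) RtrD -scalemxAr RtrZ.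
    by rewrite scalar_rC -scalemxAr RtrZ mulmx1 (Rtr_density (dst s x)) mulr1.
  under eq_bigr do rewrite mulrDr.
  rewrite big_split /= -mulr_suml (proj2 dpl) mul1r.
  under eq_bigr do rewrite mulrCA.
  rewrite -mulr_sumr.
  have := Emiss s; rewrite -/lam => h.
  have Kl : K * lam <= K * G by apply: ler_wpM2l.
  lra.
have part2 s : 4 * M%:R * (\sum_(x : {ffun 'I_l -> X}) (\prod_k p (x k)) *
     Rtr ((\sum_(y : {ffun 'I_l -> X}) (\prod_k p (y k))%:C *: codestate (W s) y) *m F x))
     <= 8 * K * G.
  have -> : \sum_(y : {ffun 'I_l -> X}) (\prod_k p (y k))%:C *: codestate (W s) y = sig s.
    by rewrite /codestate tp_mix /sig; apply: eq_tp => k; exact: mix.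
  (* tau dominates [sig s], and lam F is at most the sum of K tests, each of small weight in tau;
     dividing by lam costs one delta. *)
  have Fx x : Rtr (sig s *m F x) <= K * expR (- (l%:R * (I0 - 4 * delta))).
    apply: (@le_trans _ _ (Rtr (tau *m F x))).
      rewrite RtrC (RtrC tau); apply: (Rtr_leM (pF x)).
      exact: (lemx_term_sum s psig).
    rewrite -(ler_pM2l lam0).
    apply: (@le_trans _ _ (Rtr (tau *m (\sum_t E t x)))).
      by have := Rtr_leM ptau (Fle x); rewrite -scalemxAr RtrZ.
    rewrite mulmx_sumr Rtr_sum.
    apply: (@le_trans _ _ (\sum_(i : T) expR (- (l%:R * (I0 - 3 * delta))))).
      by apply: ler_sum => i _; exact: Etau.
    rewrite sumr_const -[leLHS]mulr_natl -/K mulrCA -expRD.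
    apply: ler_wpM2l => //; rewrite ler_expR le_eqVlt; apply/orP; left; apply/eqP; ring.
  apply: (@le_trans _ _ (4 * M%:R * (K * expR (- (l%:R * (I0 - 4 * delta)))))).
    apply: ler_wpM2l; first by rewrite mulr_ge0.
    apply: (@le_trans _ _ (\sum_(x : {ffun 'I_l -> X}) (\prod_k p (x k)) *
        (K * expR (- (l%:R * (I0 - 4 * delta)))))).
      by apply: ler_sum => x _; apply: ler_wpM2l; [case: dpl|exact: Fx].
    by rewrite -mulr_suml (proj2 dpl) mul1r.
  apply: (@le_trans _ _ (4 * (2 * expR (l%:R * (I0 - 5 * delta))) *
      (K * expR (- (l%:R * (I0 - 4 * delta)))))).
    apply: ler_wpM2r; first by rewrite mulr_ge0 // expR_ge0.
    by apply: (ler_wpM2l (ler0n R 4)).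
  have -> : 4 * (2 * expR (l%:R * (I0 - 5 * delta))) * (K * expR (- (l%:R * (I0 - 4 * delta)))) =
     8 * K * (expR (l%:R * (I0 - 5 * delta)) * expR (- (l%:R * (I0 - 4 * delta)))) by ring.
  apply: ler_wpM2l; first by rewrite mulr_ge0.
  rewrite -expRD; apply: le_trans lamg.
  rewrite ler_expR le_eqVlt; apply/orP; left; apply/eqP; ring.
apply: (@le_trans _ _ (\sum_(s : T) ((28 + 20 * K) * G))).
  apply: ler_sum => s _; have h1 := part1 s; have h2 := part2 s; lra.
by rewrite sumr_const -[leLHS]mulr_natl -/K mulrA.
Qed.

End CompoundBlock.

(** * A finite net of channels in operator order *)

Section Net.
Variable R : realType.
Local Notation C := R[i].
Local Notation adj := (@adjmx R _ _).
Local Notation "x %:C" := (real_complex R x) : ring_scope.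

Lemma norm_rC (x : R) : `|x%:C| = `|x|%:C :> C.
Proof. by rewrite normc_def /= expr0n addr0 sqrtr_sqr. Qed.

Lemma norm_le_ReIm (z : C) : `|z| <= (`|complex.Re z| + `|complex.Im z|)%:C.
Proof.
rewrite [z in leLHS]complexE rmorphD /=; apply: (le_trans (ler_normD _ _)).
by rewrite normrM !norm_rC normc_def /= expr0n expr1n add0r sqrtr1 mul1r.
Qed.

Lemma unitary_entry_le1 n (U : 'M[C]_n) i j : unitary U -> `|U i j| <= 1.
Proof.
move=> /unitaryV/(congr1 (fun M : 'M[C]_n => M i i)); rewrite !mxE eqxx mulr1n => h.
rewrite -(@expr_le1 _ 2) // sqr_normc -h (bigD1 j) //= adjmxE lerDl.
by apply: sumr_ge0 => k _; rewrite adjmxE mulcJ_ge0.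
Qed.

Lemma density_entry_le1 n (A : 'M[C]_n) i j : density A ->
  `|complex.Re (A i j)| <= 1 /\ `|complex.Im (A i j)| <= 1.
Proof.
move=> [/psd_usp[U [d [uU AE d0]]] trA].
have d1 : \sum_j d j = 1.
  by apply: (@complexI R); rewrite rmorph1 -trA AE usp_tr.
have h : `|A i j| <= 1.
  rewrite AE /usp mul_mx_diag !mxE; apply: (le_trans (ler_norm_sum _ _ _)).
  have -> : 1 = \sum_j (d j)%:C :> C by rewrite -rmorph_sum d1.
  apply: ler_sum => k _; rewrite !mxE !normrM norm_rC (ger0_norm (d0 k)).
  rewrite normcJ mulrAC ler_piMl ?ler0c //.
  by apply: mulr_ile1 => //; exact: unitary_entry_le1.
move: h; rewrite normc_def -[1]/(1%:C) lecR => h.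
have sq (x y : R) : Num.sqrt (x ^+ 2 + y ^+ 2) <= 1 -> `|x| <= 1.
  by apply: le_trans; rewrite -sqrtr_sqr ler_wsqrtr // lerDl sqr_ge0.
by split; [exact: sq h|apply: sq; rewrite addrC; exact: h].
Qed.

(** Each eigenvalue of A - B is a sum of n^2 entries of modulus at most 2 e, weighted by entries of
    unitaries. *)
Lemma lemx_entry_bound n (A B : 'M[C]_n) (e : R) : adj A = A -> adj B = B -> 0 <= e ->
  (forall i j, `|complex.Re (A i j) - complex.Re (B i j)| <= e /\
     `|complex.Im (A i j) - complex.Im (B i j)| <= e) ->
  lemx A (B + (n%:R * n%:R * (2 * e))%:C%:M).
Proof.
move=> hA hB e0 h.
have hH : adj (A - B) = A - B by rewrite adjmxB hA hB.
have [U [d [uU HE]]] := herm_usp hH.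
have dle j : d j <= n%:R * n%:R * (2 * e).
  have E : (d j)%:C = (adj U *m (A - B) *m U) j j.
    by rewrite HE usp_diag // !mxE eqxx mulr1n.
  have : `|(d j)%:C| <= (n%:R * n%:R * (2 * e))%:C.
    rewrite E mxE; apply: (le_trans (ler_norm_sum _ _ _)).
    have -> : (n%:R * n%:R * (2 * e))%:C = \sum_(k < n) \sum_(i < n) (2 * e)%:C :> C.
      by rewrite !sumr_const card_ord !(rmorphM, rmorph_nat) -mulrA !mulr_natl.
    apply: ler_sum => k _; rewrite normrM.
    apply: (@le_trans _ _ `|(adj U *m (A - B)) j k|).
      by rewrite ler_piMr // unitary_entry_le1.
    rewrite mxE; apply: (le_trans (ler_norm_sum _ _ _)).
    apply: ler_sum => i _; rewrite normrM adjmxE normcJ.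
    apply: (@le_trans _ _ `|(A - B) i k|).
      by rewrite ler_piMl // unitary_entry_le1.
    apply: (le_trans (norm_le_ReIm _)); rewrite lecR.
    have [h1 h2] := h i k; rewrite !mxE.
    case: (A i k) (B i k) h1 h2 => [x y] [x' y'] /=; lra.
  rewrite norm_rC lecR; apply: le_trans; exact: ler_norm.
have -> : A = B + usp U d by rewrite -HE addrC subrK.
rewrite -(usp_cst uU); rewrite /lemx opprD addrACA subrr add0r uspB.
by apply: usp_psd => // j; rewrite subr_ge0.
Qed.

(** All real and imaginary parts of matrix entries lie in [-1, 1], which is cut into cells of width
    e; T is the set of all cell patterns. The representatives are taken in [Wset], so that lower
    bounds on the Holevo information hold for them too. *)
Lemma channel_net (X : finType) n (Wset : set (X -> 'M[C]_n)) (eta : R) W0 : Wset W0 ->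
  (forall W, Wset W -> cq_channel W) -> 0 < eta ->
  exists (T : finType) (w : T -> X -> 'M[C]_n),
    (forall t, Wset (w t)) /\
    (forall W, Wset W -> exists t, forall x, lemx (W x) (w t x + eta%:C%:M)).
Proof.
move=> WW0 hW e0.
pose e := eta / (n%:R * n%:R * 2 + 1).
have D0 : 0 < n%:R * n%:R * 2 + 1 :> R by rewrite ltr_wpDl // !mulr_ge0.
have e'0 : 0 < e by apply: divr_gt0.
have hne : n%:R * n%:R * (2 * e) <= eta.
  rewrite mulrA /e mulrA ler_pdivrMr // mulrC; apply: ler_wpM2l; [exact: ltW|lra].
pose m := (Num.truncn (2 / e)).+1.
pose cell (y : R) : 'I_m.+1 := inord (Num.truncn ((y + 1) / e)).
have cellP (y y' : R) : `|y| <= 1 -> `|y'| <= 1 -> cell y = cell y' -> `|y - y'| <= e.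
  move=> hy hy' /(congr1 val) /=.
  have tr (z : R) : `|z| <= 1 -> (Num.truncn ((z + 1) / e) < m.+1)%N.
    rewrite ler_norml => /andP[z1 z2]; rewrite ltnS ltnW // ltnS.
    apply: le_truncn; rewrite ler_pM2r ?invr_gt0 //; lra.
  rewrite !inordK ?tr // => E.
  have it (z : R) : `|z| <= 1 ->
     (Num.truncn ((z + 1) / e))%:R * e <= z + 1 < (Num.truncn ((z + 1) / e))%:R * e + e.
    rewrite ler_norml => /andP[z1 z2].
    have z0 : 0 <= (z + 1) / e by apply: divr_ge0; [lra|exact: ltW].
    have /andP[i1 i2] := truncn_itv z0.
    rewrite -ler_pdivlMr // i1 /=.
    by move: i2; rewrite ltr_pdivrMr // -natr1 mulrDl mul1r.
  have /andP[a1 a2] := it _ hy; have /andP[a3 a4] := it _ hy'; rewrite E in a1 a2.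
  rewrite ler_norml; apply/andP; split; lra.
pose T : finType := {ffun X * 'I_n * 'I_n * bool -> 'I_m.+1}.
pose part (b : bool) (z : C) := if b then complex.Re z else complex.Im z.
pose code (W : X -> 'M[C]_n) : T := [ffun q => cell (part q.2 (W q.1.1.1 q.1.1.2 q.1.2))].
(* A pattern met by no channel of the family gets the default [W0]. *)
have /(_ _)/cid rep (t : T) : exists W, Wset W /\ ((exists W', Wset W' /\ code W' = t) -> code W = t).
  have [[W [h1 h2]]|h] := pselect (exists W', Wset W' /\ code W' = t).
    by exists W.
  by exists W0.
exists T, (fun t => sval (rep t)); split; first by move=> t; case: (rep t) => W [].
move=> W hWW; exists (code W) => x; case: (rep (code W)) => W' /= [hW' /(_ _)].
move=> /(_ (ex_intro _ W (conj hWW erefl))) cE.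
have dW := hW _ hWW x; have dW' := hW _ hW' x.
apply: (@lemx_trans _ _ (W' x + (n%:R * n%:R * (2 * e))%:C%:M)).
  apply: lemx_entry_bound; [exact: psdmx_herm (proj1 dW)|exact: psdmx_herm (proj1 dW')|exact: ltW|].
  move=> i j; have [r1 i1] := density_entry_le1 i j dW.
  have [r2 i2] := density_entry_le1 i j dW'.
  split; apply: cellP => //.
    by have /ffunP/(_ (x, i, j, true)) := cE; rewrite !ffunE /= => ->.
  by have /ffunP/(_ (x, i, j, false)) := cE; rewrite !ffunE /= => ->.
rewrite /lemx opprD addrACA subrr add0r (scalar_rC _ eta) (scalar_rC _ (_ * _)) -scalerBl -rmorphB.
by apply: psdmxZ; [rewrite subr_ge0|exact: psdmx1].
Qed.

End Net.

(** * Codes for the whole family *)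

Section Achievability.
Variable R : realType.
Local Notation C := R[i].
Local Notation adj := (@adjmx R _ _).
Local Notation "x %:C" := (real_complex R x) : ring_scope.

Lemma usp_smoothed n (U : 'M[C]_n) d (eta : R) : unitary U ->
  usp U (smoothed d eta) = ((1 + n%:R * eta)^-1)%:C *: (usp U d + eta%:C%:M).
Proof.
move=> uU; rewrite -(usp_cst uU) uspD uspZ; apply: usp_eq => j.
by rewrite /smoothed /= mulrC.
Qed.

Lemma density_usp n (A : 'M[C]_n) : density A ->
  exists Ud : 'M[C]_n * ('I_n -> R), [/\ unitary Ud.1, A = usp Ud.1 Ud.2,
    forall j, 0 <= Ud.2 j, \sum_j Ud.2 j = 1 & ln 2 * vN_entropy A = Hs Ud.2].
Proof.
move=> [/psd_usp[U [d [uU AE d0]]] trA]; exists (U, d); split => //=.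
  by apply: (@complexI R); rewrite rmorph1 -trA AE usp_tr.
by rewrite AE vN_entropy_usp.
Qed.

Lemma ln2_gt0 : 0 < ln 2 :> R.
Proof. by rewrite ln_gt0 // ltr1n. Qed.

Lemma avg_err_codestate (X : finType) n l M (W : X -> 'M[C]_n)
    (u : 'I_M -> {ffun 'I_l -> X}) (D : 'I_M -> 'M[C]_(n ^ l)) :
  avg_err W (fun m => [tuple u m k | k < l]) D =
  M%:R^-1 * \sum_m Rtr (codestate W (u m) *m (1%:M - D m)).
Proof.
congr (_ * _); apply: eq_bigr => m _; rewrite /Rtr /codestate tenspowE.
by congr (complex.Re (\tr (_ *m _))); apply: eq_tp => k; rewrite tnth_mktuple.
Qed.

(** Of the 7 delta, 2 pay for smoothing the entropies of outputs and signals, and 5 are required by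
    the block code. *)
Lemma compound_codes (X : finType) n (Wset : set (X -> 'M[C]_n)) (p : X -> R) W0 (r delta : R) :
  Wset W0 -> (forall W, Wset W -> cq_channel W) -> is_distr p ->
  0 <= r -> 0 < delta -> delta <= 16 ->
  (forall W, Wset W -> ln 2 * r + 7 * delta <= ln 2 * holevo p W) ->
  exists K gamma : R, 0 < gamma /\ forall l, exists M (u : 'I_M -> l.-tuple X)
      (D : 'I_M -> 'M[C]_(n ^ l)),
    [/\ (0 < M)%N, is_code u D, expR (l%:R * (ln 2 * r)) <= M%:R &
      forall W, Wset W -> avg_err W u D <= K * expR (- (l%:R * gamma))].
Proof.
move=> WW0 hW dp r0 d0 d16 hr.
have [x0 _] : exists x : X, true.
  case: dp => _ h; apply/existsP; apply: contraT; rewrite negb_exists => /forallP nx.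
  by move: h; rewrite big1 => [/esym/eqP|x]; [rewrite oner_eq0|have := nx x].
have n0 : (0 < n)%N.
  case: (hW _ WW0 x0) => _; case: (n) (W0 x0) => // A.
  by rewrite /mxtrace big_ord0 => /esym/eqP; rewrite oner_eq0.
have nR : 0 < n%:R :> R by rewrite ltr0n.
pose gamma : R := delta ^+ 2 / (64 * n%:R).
have g0 : 0 < gamma by apply: divr_gt0; [exact: exprn_gt0|apply: mulr_gt0].
have g2 : 0 < gamma / 2 by apply: divr_gt0.
(* eta comes after gamma: n eta <= gamma / 2 ensures that (1 + n eta)^l uses up at most half of the
   exponent. *)
have [eta [e0 e1 eg es1 es2]] := smoothing_parameter n d0 g2.
have [T [w [wW net]]] := channel_net WW0 hW e0.
have /(_ _ _)/cid spec t x := density_usp (hW _ (wW t) x).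
have dsig t := mixture_density dp (hW _ (wW t)).
have /(_ _)/cid spec2 t := density_usp (dsig t).
pose V t x := (sval (spec t x)).1; pose d t x := (sval (spec t x)).2.
pose U t := (sval (spec2 t)).1; pose b t := (sval (spec2 t)).2.
have uV t x : unitary (V t x) by rewrite /V; case: (spec t x) => /= s [].
have wE t x : w t x = usp (V t x) (d t x) by rewrite /V /d; case: (spec t x) => /= s [].
have dd0 t x j : 0 <= d t x j by rewrite /d; case: (spec t x) => /= s [].
have dd1 t x : \sum_j d t x j = 1 by rewrite /d; case: (spec t x) => /= s [].
have dS t x : ln 2 * vN_entropy (w t x) = Hs (d t x) by rewrite /d; case: (spec t x) => /= s [].
have uU t : unitary (U t) by rewrite /U; case: (spec2 t) => /= s [].
have sE t : \sum_x (p x)%:C *: w t x = usp (U t) (b t) by rewrite /U /b; case: (spec2 t) => /= s [].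
have b0 t j : 0 <= b t j by rewrite /b; case: (spec2 t) => /= s [].
have b1 t : \sum_j b t j = 1 by rewrite /b; case: (spec2 t) => /= s [].
have bS t : ln 2 * vN_entropy (\sum_x (p x)%:C *: w t x) = Hs (b t).
  by rewrite /b; case: (spec2 t) => /= s [].
clearbody V d U b; clear spec spec2.
pose c : R := 1 + n%:R * eta.
have c0 : 0 < c by rewrite ltr_wpDr // mulr_ge0 // ltW.
have sm0 (f : 'I_n -> R) j : (forall j, 0 <= f j) -> 0 < smoothed f eta j.
  by move=> f0; apply: divr_gt0 => //; rewrite ltr_wpDl.
(* Smoothing is affine with coefficients independent of x, so it commutes with averaging under p. *)
have mix t : \sum_x (p x)%:C *: usp (V t x) (smoothed (d t x) eta) = usp (U t) (smoothed (b t) eta).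
  rewrite usp_smoothed // -sE.
  under eq_bigr do rewrite usp_smoothed // -wE scalerA mulrC -scalerA scalerDr.
  rewrite -scaler_sumr big_split /= -scaler_suml; congr (_ *: (_ + _)).
  by rewrite -rmorph_sum (proj2 dp) scale1r.
have chi t : ln 2 * r + 7 * delta - 2 * delta <=
    Hs (smoothed (b t) eta) - \sum_x p x * Hs (smoothed (d t x) eta).
  have := hr _ (wW t); rewrite /holevo mulrBr bS mulr_sumr => h.
  have h1 := Hs_smoothed_ge (b0 t) (b1 t) e0 e1.
  have h2 : \sum_x p x * Hs (smoothed (d t x) eta) <= \sum_x ln 2 * (p x * vN_entropy (w t x)) + delta.
    have -> : delta = \sum_x p x * delta by rewrite -mulr_suml (proj2 dp) mul1r.
    rewrite -big_split /=; apply: ler_sum => x _; rewrite mulrCA dS -mulrDr.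
    apply: ler_wpM2l; first by case: dp.
    apply: (le_trans (Hs_smoothed_le (dd0 t x) (dd1 t x) e0 e1)).
    by rewrite -addrA lerD2l.
  lra.
pose K : R := #|T|%:R * (28 + 20 * #|T|%:R).
have K0 : 0 <= K by rewrite mulr_ge0 // addr_ge0 // mulr_ge0.
exists K, (gamma / 2); split=> // l.
(* Rounding up at most doubles a number that is at least 1. *)
pose M := (Num.truncn (expR (l%:R * (ln 2 * r)))).+1.
have lr : 0 <= l%:R * (ln 2 * r) by rewrite !mulr_ge0 // ltW // ln2_gt0.
have /andP[M1 M2] := truncn_itv (expR_ge0 (l%:R * (ln 2 * r))).
have Mle : M%:R <= 2 * expR (l%:R * (ln 2 * r + 7 * delta - 2 * delta - 5 * delta)).
  have -> : ln 2 * r + 7 * delta - 2 * delta - 5 * delta = ln 2 * r by ring.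
  rewrite /M -natr1; have : 1 <= expR (l%:R * (ln 2 * r)) by rewrite -[leLHS]expR0 ler_expR.
  lra.
have [u [D [pD D1 hD]]] := @compound_block_code R X T n l M p V (fun t x => smoothed (d t x) eta)
  U (fun t => smoothed (b t) eta) delta _ n0 dp uV uU (fun t x j => sm0 _ j (dd0 t x))
  (fun t x => sum_smoothed (dd1 t x) e0) (fun t j => sm0 _ j (b0 t)) (fun t => sum_smoothed (b1 t) e0)
  mix d0 d16 chi (ltn0Sn _) Mle.
exists M, (fun m => [tuple u m k | k < l]), D; split => //; first exact: ltW.
move=> W hWW; have [t ht] := net W hWW; rewrite avg_err_codestate.
have dom m : lemx (codestate W (u m))
    ((c ^+ l)%:C *: codestate (fun x => usp (V t x) (smoothed (d t x) eta)) (u m)).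
  have -> : c ^+ l = \prod_(k < l) c by rewrite prodr_const card_ord.
  rewrite /codestate -tpZ; apply: tp_lemx => k; first by case: (hW _ hWW (u m k)).
  rewrite usp_smoothed // scalerA -rmorphM divff ?gt_eqF // scale1r -wE; exact: ht.
have errm m : Rtr (codestate W (u m) *m (1%:M - D m)) <= c ^+ l *
    Rtr (codestate (fun x => usp (V t x) (smoothed (d t x) eta)) (u m) *m (1%:M - D m)).
  have pD1 : psdmx (1%:M - D m).
    exact: (lemx_trans (lemx_term_sum m pD) D1).
  by rewrite RtrC; apply: (le_trans (Rtr_leM pD1 (dom m))); rewrite -scalemxAr RtrZ RtrC.
apply: (@le_trans _ _ (c ^+ l * (K * expR (- (l%:R * gamma))))).
  apply: (@le_trans _ _ (c ^+ l * (M%:R^-1 * \sum_m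
     Rtr (codestate (fun x => usp (V t x) (smoothed (d t x) eta)) (u m) *m (1%:M - D m))))).
    rewrite mulrCA ler_wpM2l ?invr_ge0 // mulr_sumr; apply: ler_sum => m _; exact: errm.
  by apply: ler_wpM2l; [apply: exprn_ge0; exact: ltW|exact: hD].
rewrite mulrCA; apply: ler_wpM2l => //.
apply: (@le_trans _ _ (expR (l%:R * (gamma / 2)) * expR (- (l%:R * gamma)))).
  apply: ler_wpM2r; first exact: expR_ge0.
  have cE : c <= expR (gamma / 2) by apply: le_trans (expR_ge1Dx _) _; rewrite ler_expR.
  by rewrite expRM_natl; apply: lerXn2r cE; rewrite nnegrE ?expR_ge0 // ltW.
by rewrite -expRD ler_expR le_eqVlt; apply/orP; left; apply/eqP; field.
Qed.

End Achievability.

(** * Converse *)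

Section Converse.
Variable R : realType.
Local Notation C := R[i].
Local Notation adj := (@adjmx R _ _).
Local Notation "x %:C" := (real_complex R x) : ring_scope.

Definition normsq (z : C) : R := complex.Re z ^+ 2 + complex.Im z ^+ 2.

Lemma normsq_ge0 z : 0 <= normsq z.
Proof. by rewrite addr_ge0 // sqr_ge0. Qed.

Lemma normsqE z : (normsq z)%:C = z * conjc z.
Proof.
case: z => a b; apply/eqP; rewrite eq_complex /normsq /=; apply/andP; split; apply/eqP; ring.
Qed.

Lemma normsq_conjc z : normsq (conjc z) = normsq z.
Proof. by case: z => a b; rewrite /normsq /= sqrrN. Qed.

Lemma normsqD_le x y : normsq (x + y) <= 2 * (normsq x + normsq y).
Proof.
case: x y => [a b] [a' b']; rewrite /normsq /=.
have := sqr_ge0 (a - a'); have := sqr_ge0 (b - b'); nra.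
Qed.

Section Overlap.
Variables (n : nat) (U V : 'M[C]_n).
Hypotheses (uU : unitary U) (uV : unitary V).

(** V is arbitrary: inserting V [adj V] between the two factors A leaves matrix elements between the
    two bases. *)
Lemma Rtr_usp_sqr (A : 'M[C]_n) (a : 'I_n -> R) : adj A = A ->
  Rtr (usp U a *m (A *m A)) = \sum_i \sum_j a i * normsq ((adj U *m A *m V) i j).
Proof.
move=> hA.
have -> : Rtr (usp U a *m (A *m A)) =
    Rtr (diag_mx (\row_j (a j)%:C) *m ((adj U *m A *m V) *m adj (adj U *m A *m V))).
  rewrite !adjmxM hA adjmxK /usp RtrC !mulmxA -(mulmxA _ V (adj V)) unitaryV // mulmx1.
  by rewrite RtrC !mulmxA RtrC !mulmxA.
rewrite /Rtr /mxtrace Re_sum; apply: eq_bigr => i _.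
rewrite mul_diag_mx mxE mxE Re_rC [X in complex.Re X]mxE Re_sum mulr_sumr.
by apply: eq_bigr => j _; rewrite adjmxE -normsqE.
Qed.

Lemma Rtr_usp_usp (a f : 'I_n -> R) :
  Rtr (usp U a *m usp V f) = \sum_i \sum_j a i * normsq ((adj U *m V) i j) * f j.
Proof.
have -> : Rtr (usp U a *m usp V f) =
    Rtr (diag_mx (\row_j (a j)%:C) *m ((adj U *m V *m diag_mx (\row_j (f j)%:C)) *m adj (adj U *m V))).
  by rewrite !adjmxM adjmxK /usp -[LHS]RtrC !mulmxA RtrC !mulmxA RtrC !mulmxA.
rewrite /Rtr /mxtrace Re_sum; apply: eq_bigr => i _.
rewrite mul_diag_mx mxE mxE Re_rC [X in complex.Re X]mxE Re_sum mulr_sumr.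
apply: eq_bigr => j _; rewrite adjmxE mul_mx_diag !mxE mulrAC -normsqE -mulrA.
by rewrite -rmorphM.
Qed.

Lemma overlap_row i : \sum_j normsq ((adj U *m V) i j) = 1.
Proof.
apply: (@complexI R); rewrite rmorph_sum rmorph1.
have := unitaryV (unitaryM (unitary_adj uU) uV).
move=> /(congr1 (fun M : 'M[C]_n => M i i)); rewrite [RHS]mxE eqxx mulr1n => h; rewrite -[RHS]h.
by rewrite [RHS]mxE; apply: eq_bigr => j _; rewrite adjmxE -normsqE.
Qed.

Lemma overlap_col j : \sum_i normsq ((adj U *m V) i j) = 1.
Proof.
apply: (@complexI R); rewrite rmorph_sum rmorph1.
have := unitaryM (unitary_adj uU) uV.
move=> /(congr1 (fun M : 'M[C]_n => M j j)); rewrite [RHS]mxE eqxx mulr1n => h; rewrite -[RHS]h.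
by rewrite [RHS]mxE; apply: eq_bigr => i _; rewrite adjmxE mulrC -normsqE.
Qed.

End Overlap.

Section OneShot.
Variables (n : nat) (U V : 'M[C]_n) (a b : 'I_n -> R).
Hypotheses (uU : unitary U) (uV : unitary V).
Hypotheses (a0 : forall i, 0 <= a i) (a1 : \sum_i a i = 1) (b0 : forall j, 0 < b j).
Let g i j := normsq ((adj U *m V) i j).

(* The errors of any test dominate those of testing a_i g_ij against b_j g_ij. *)
Lemma test_error_bound (c : R) (E : 'M[C]_n) : 0 <= c -> psdmx E -> lemx E 1%:M ->
  \sum_i \sum_j Num.min (a i) (c * b j) * g i j <=
  2 * (Rtr (usp U a *m (1%:M - E)) + c * Rtr (usp V b *m E)).
Proof.
move=> c0 pE E1; have hE := psdmx_herm pE.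
have hE1 : adj (1%:M - E) = 1%:M - E by rewrite adjmxB adjmx1 hE.
have pE1 : psdmx (1%:M - E) := E1.
have pa : psdmx (usp U a) by exact: (usp_psd uU).
have pb : psdmx (usp V b) by apply: (usp_psd uV) => j; exact: ltW.
have E1' : lemx (1%:M - E) 1%:M by rewrite /lemx opprB addrC subrK.
(* E need not be a projection; E^2 <= E still bounds its trace from below by squared matrix
   elements. *)
have h1 := Rtr_leM pa (lemx_sqr pE1 E1').
have h2 := Rtr_leM pb (lemx_sqr pE E1).
rewrite (Rtr_usp_sqr U uV _ hE1) in h1; rewrite (Rtr_usp_sqr V uU _ hE) in h2.
have {}h2 := ler_wpM2l c0 h2.
apply: (@le_trans _ _ (2 * (\sum_i \sum_j a i * normsq ((adj U *m (1%:M - E) *m V) i j) +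
   c * \sum_j \sum_i b j * normsq ((adj V *m E *m U) j i)))); last first.
  by apply: (ler_wpM2l (ler0n R 2)); apply: lerD.
rewrite [\sum_j \sum_i b j * _]exchange_big /= mulr_sumr -big_split /= mulr_sumr.
apply: ler_sum => i _; rewrite mulr_sumr -big_split /= mulr_sumr; apply: ler_sum => j _.
set x := normsq _; set y := normsq ((adj V *m E *m U) j i).
have -> : y = normsq ((adj U *m E *m V) i j).
  rewrite /y -normsq_conjc -adjmxE !adjmxM adjmxK hE mulmxA //.
(* The overlap of two eigenvectors splits along 1 = (1 - E) + E; this is the origin of the factor
   2. *)
have gE : g i j <= 2 * (x + normsq ((adj U *m E *m V) i j)).
  rewrite /g (_ : adj U *m V = adj U *m (1%:M - E) *m V + adj U *m E *m V).
    by rewrite mxE; exact: normsqD_le.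
  by rewrite -mulmxDl -mulmxDr subrK mulmx1.
have x0 : 0 <= x by exact: normsq_ge0.
have y0 := normsq_ge0 ((adj U *m E *m V) i j).
move: (normsq ((adj U *m E *m V) i j)) gE y0 => z gE z0.
have m0 : 0 <= Num.min (a i) (c * b j) by rewrite le_min a0 mulr_ge0 // ltW.
apply: (le_trans (ler_wpM2l m0 gE)).
have ma : Num.min (a i) (c * b j) <= a i by rewrite ge_min lexx.
have mb : Num.min (a i) (c * b j) <= c * b j by rewrite ge_min lexx orbT.
rewrite mulrCA mulrDr (mulrA c); apply: (ler_wpM2l (ler0n R 2)).
by apply: lerD; apply: ler_wpM2r.
Qed.

Lemma sum_overlap_l (f : 'I_n -> R) : \sum_i \sum_j f i * g i j = \sum_i f i.
Proof. by apply: eq_bigr => i _; rewrite -mulr_sumr overlap_row // mulr1. Qed.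

Lemma sum_overlap_r (f : 'I_n -> R) : \sum_i \sum_j f j * g i j = \sum_j f j.
Proof.
by rewrite exchange_big; apply: eq_bigr => j _; rewrite -mulr_sumr overlap_col // mulr1.
Qed.

(** The right side is the relative entropy of the two operators plus a trace: it is
    [relative_entropy_pointwise] summed with the weights [g i j], whose rows and columns add up to
    1. *)
Lemma one_shot_converse (c : R) (E : 'M[C]_n) : 1 <= c -> psdmx E -> lemx E 1%:M ->
  ln c * (1 - 2 * (Rtr (usp U a *m (1%:M - E)) + c * Rtr (usp V b *m E))) <=
  - Hs a - Rtr (usp U a *m usp V (fun j => ln (b j))) + \sum_j b j.
Proof.
move=> c1 pE E1; have c0 : 0 <= c by lra.
have lc : 0 <= ln c by exact: ln_ge0.
have h := test_error_bound c0 pE E1.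
apply: (@le_trans _ _ (ln c * (1 - \sum_i \sum_j Num.min (a i) (c * b j) * g i j))).
  by apply: ler_wpM2l => //; rewrite lerD2l lerN2.
have -> : 1 - \sum_i \sum_j Num.min (a i) (c * b j) * g i j =
    \sum_i \sum_j (a i - Num.min (a i) (c * b j)) * g i j.
  rewrite -[X in X - _]a1 -(sum_overlap_l a) -sumrB; apply: eq_bigr => i _.
  by rewrite -sumrB; apply: eq_bigr => j _; rewrite mulrBl.
have -> : - Hs a - Rtr (usp U a *m usp V (fun j => ln (b j))) + \sum_j b j =
    \sum_i \sum_j (a i * ln (a i) - a i * ln (b j) + b j) * g i j.
  rewrite /Hs opprK -(sum_overlap_l (fun i => a i * ln (a i))) -(sum_overlap_r b) Rtr_usp_usp -sumrB -big_split /=.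
  apply: eq_bigr => i _; rewrite -sumrB -big_split /=; apply: eq_bigr => j _.
  by rewrite -/(g i j); ring.
rewrite mulr_sumr; apply: ler_sum => i _; rewrite mulr_sumr; apply: ler_sum => j _.
by rewrite mulrA ler_wpM2r ?normsq_ge0 // relative_entropy_pointwise.
Qed.

(** The same pairing reduces Klein's inequality to its scalar case, the tangent line of the
    logarithm. *)
Lemma klein : 1 - \sum_j b j <= - Hs a - Rtr (usp U a *m usp V (fun j => ln (b j))).
Proof.
rewrite -a1 -(sum_overlap_l a) -(sum_overlap_r b) /Hs opprK.
rewrite -(sum_overlap_l (fun i => a i * ln (a i))) Rtr_usp_usp -!sumrB.
apply: ler_sum => i _; rewrite -!sumrB; apply: ler_sum => j _.
rewrite -mulrBl [leRHS](_ : _ = (a i * ln (a i) - a i * ln (b j)) * g i j).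
  2: by rewrite /g; ring.
rewrite ler_wpM2r ?normsq_ge0 //.
have := a0 i; rewrite le_eqVlt => /predU1P[<-|ai].
  by rewrite !mul0r subrr sub0r oppr_le0 ltW.
have h : a i * (ln (b j) - ln (a i)) <= a i * (b j / a i - 1).
  by rewrite ler_pM2l // -ln_div ?posrE // ln_le_sub1 // divr_gt0.
have ab : a i * (b j / a i) = b j by rewrite mulrC divfK ?gt_eqF.
by move: h; rewrite !mulrBr mulr1 ab; lra.
Qed.

End OneShot.

End Converse.

(** * Converse for block codes *)

Section BlockConverse.
Variable R : realType.
Local Notation C := R[i].
Local Notation adj := (@adjmx R _ _).
Local Notation "x %:C" := (real_complex R x) : ring_scope.

Lemma usp_sum (I : finType) n (U : 'M[C]_n) (h : I -> 'I_n -> R) :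
  usp U (fun j => \sum_i h i j) = \sum_i usp U (h i).
Proof.
rewrite /usp -mulmx_suml -mulmx_sumr; congr (_ *m _ *m _).
apply/matrixP => i j; rewrite summxE !mxE rmorph_sum -sumrMnl.
by apply: eq_bigr => k _; rewrite !mxE.
Qed.

(** The k-th summand acts on one tensor factor only; every other factor contributes trace 1. *)
Lemma Rtr_tp_sum n l (A V : 'I_l -> 'M[C]_n) (f : 'I_l -> 'I_n -> R) :
  (forall k, density (A k)) -> (forall k, unitary (V k)) ->
  Rtr (tp A *m usp (tp V) (fun i => \sum_k f k (digit i k))) =
  \sum_k Rtr (A k *m usp (V k) (f k)).
Proof.
move=> dA uV; rewrite usp_sum mulmx_sumr Rtr_sum; apply: eq_bigr => k _.
have -> : usp (tp V) (fun i => f k (digit i k)) =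
    tp (fun k' => usp (V k') (fun j => if k' == k then f k j else 1)).
  rewrite tp_usp; apply: usp_eq => i; rewrite (bigD1 k) //= eqxx big1 ?mulr1 //.
  by move=> k' /negbTE ->.
rewrite tpM /Rtr tp_tr (bigD1 k) //= eqxx big1 ?mulr1 // => k' /negbTE ->.
by rewrite usp1 // mulmx1; case: (dA k').
Qed.

Lemma ln_prod l (v : 'I_l -> R) : (forall k, 0 < v k) ->
  ln (\prod_k v k) = \sum_k ln (v k).
Proof. by move=> v0; rewrite prod_expR_ln // expRK. Qed.

Lemma Hs_prod n l (a : 'I_l -> 'I_n -> R) :
  (forall k j, 0 <= a k j) -> (forall k, \sum_j a k j = 1) ->
  Hs (fun i : 'I_(n ^ l) => \prod_k a k (digit i k)) = \sum_k Hs (a k).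
Proof.
move=> a0 a1; rewrite /Hs sumrN; congr (- _).
transitivity (\sum_(i : 'I_(n ^ l)) \sum_k (\prod_k' a k' (digit i k')) * ln (a k (digit i k))).
  apply: eq_bigr => i _; rewrite -mulr_sumr.
  have P0 : 0 <= \prod_k a k (digit i k) by apply: prodr_ge0.
  move: P0; rewrite le_eqVlt => /predU1P[<-|P0]; first by rewrite !mul0r.
  rewrite ln_prod // => k; rewrite lt_neqAle a0 andbT eq_sym.
  by apply: contraTneq P0 => ak; rewrite (bigD1 k) //= ak mul0r ltxx.
rewrite exchange_big; apply: eq_bigr => k _.
rewrite (sum_digit (fun f : {ffun 'I_l -> 'I_n} => (\prod_k' a k' (f k')) * ln (a k (f k)))).
exact: (sum_ffun_marginal k (fun j => ln (a k j)) a1).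
Qed.

Definition empirical (X : finType) l M (u : 'I_M -> l.-tuple X) (x : X) : R :=
  (M%:R * l%:R)^-1 * \sum_m \sum_k (tnth (u m) k == x)%:R.

Lemma empirical_sum (X : finType) l M (u : 'I_M -> l.-tuple X) (h : X -> R) :
  \sum_x empirical u x * h x = (M%:R * l%:R)^-1 * \sum_m \sum_k h (tnth (u m) k).
Proof.
rewrite /empirical; under eq_bigr do rewrite -mulrA mulr_suml.
rewrite -mulr_sumr exchange_big /=; congr (_ * _); apply: eq_bigr => m _.
under eq_bigr do rewrite mulr_suml.
rewrite exchange_big; apply: eq_bigr => k _.
rewrite (bigD1 (tnth (u m) k)) //= eqxx mul1r big1 ?addr0 // => x.
by rewrite eq_sym => /negbTE ->; rewrite mul0r.
Qed.

Lemma empirical_distr (X : finType) l M (u : 'I_M -> l.-tuple X) :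
  (0 < l)%N -> (0 < M)%N -> is_distr (empirical u).
Proof.
move=> l0 M0; split.
  move=> x; rewrite mulr_ge0 ?invr_ge0 ?mulr_ge0 // sumr_ge0 // => m _.
  by apply: sumr_ge0 => k _; exact: ler0n.
have := empirical_sum u (fun=> 1); under eq_bigr do rewrite mulr1.
move=> ->; under eq_bigr do rewrite sumr_const card_ord.
rewrite sumr_const card_ord -mulrnA mulnC -natrM mulVf //.
by rewrite pnatr_eq0 muln_eq0 negb_or -!lt0n M0.
Qed.

Lemma cross_entropy_smoothed n (s : 'I_n -> R) (eta : R) :
  (forall j, 0 <= s j) -> \sum_j s j = 1 -> 0 < eta ->
  - \sum_j s j * ln (smoothed s eta j) <= Hs s + n%:R * eta.
Proof.
move=> s0 s1 e0; have c0 : 0 < 1 + n%:R * eta by rewrite ltr_wpDr // mulr_ge0 // ltW.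
have -> : n%:R * eta = \sum_j s j * (n%:R * eta) by rewrite -mulr_suml s1 mul1r.
rewrite /Hs -!sumrN -big_split /=.
apply: ler_sum => j _; have := s0 j; rewrite le_eqVlt => /predU1P[<-|sj].
  by rewrite !mul0r addr0.
have h1 : s j * ln (smoothed s eta j) = s j * ln (s j + eta) - s j * ln (1 + n%:R * eta).
  have dj : 0 < s j + eta by exact: addr_gt0.
  by rewrite /smoothed ln_div ?posrE // mulrBr.
have h2 : s j * ln (s j) <= s j * ln (s j + eta).
  by rewrite ler_pM2l // ler_ln ?posrE ?addr_gt0 // lerDl ltW.
have h3 : s j * ln (1 + n%:R * eta) <= s j * (n%:R * eta).
  rewrite ler_pM2l //; apply: (le_trans (ln_le_sub1 c0)); rewrite lerBlDl //.
rewrite h1; lra.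
Qed.

(** All codewords are tested against one state [sig]; since the D m sum to at most 1, their average
    weight in it is at most 1 / M. The relative entropies [h] add up over positions, and their
    average over the codebook is l times their mean under the empirical distribution. Smoothing
    keeps the logarithms finite; the final 1 is the trace of [sig]. *)
Lemma code_bound (X : finType) n l M (u : 'I_M -> l.-tuple X)
    (D : 'I_M -> 'M[C]_(n ^ l)) (W : X -> 'M[C]_n) (c eta : R) :
  (0 < l)%N -> (0 < M)%N -> is_code u D -> cq_channel W -> 1 <= c -> 0 < eta ->
  ln c * (1 - 2 * (avg_err W u D + c / M%:R)) <=
  l%:R * (ln 2 * holevo (empirical u) W + n%:R * eta) + 1.
Proof.
move=> l0 M0 [pD D1] dW c1 e0.
have dp := empirical_distr u l0 M0.
set p := empirical u.
have MR : 0 < M%:R :> R by rewrite ltr0n.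
have lR : 0 < l%:R :> R by rewrite ltr0n.
have /(_ _)/cid spec x := density_usp (dW x).
pose Ux x := (sval (spec x)).1; pose a x := (sval (spec x)).2.
have uU x : unitary (Ux x) by rewrite /Ux; case: (spec x) => /= s [].
have WE x : W x = usp (Ux x) (a x) by rewrite /Ux /a; case: (spec x) => /= s [].
have a0 x j : 0 <= a x j by rewrite /a; case: (spec x) => /= s [].
have a1 x : \sum_j a x j = 1 by rewrite /a; case: (spec x) => /= s [].
have aS x : ln 2 * vN_entropy (W x) = Hs (a x) by rewrite /a; case: (spec x) => /= s [].
clearbody Ux a; clear spec.
have [[V s] /= [uV sE s0 s1 sS]] := density_usp (mixture_density dp dW).
pose b := smoothed s eta.
have cn : 0 < 1 + n%:R * eta by rewrite ltr_wpDr // mulr_ge0 // ltW.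
have b0 j : 0 < b j by apply: divr_gt0 => //; rewrite ltr_wpDl.
have b1 : \sum_j b j = 1 by exact: sum_smoothed.
pose h x := - Hs (a x) - Rtr (W x *m usp V (fun j => ln (b j))).
pose sig : 'M[C]_(n ^ l) := usp (tp (fun=> V)) (fun i => \prod_k b (digit i k)).
have bb1 : \sum_(i : 'I_(n ^ l)) \prod_k b (digit i k) = 1.
  rewrite (sum_digit (fun f : {ffun 'I_l -> 'I_n} => \prod_k b (f k))).
  by rewrite (sum_ffun_prod (fun _ => b)) big1.
have bb0 (i : 'I_(n ^ l)) : 0 < \prod_(k < l) b (digit i k) by apply: prodr_gt0.
have uVV : unitary (tp (fun _ : 'I_l => V)) by exact: tp_unitary.
have psig : psdmx sig by apply: (usp_psd uVV) => i; exact: ltW.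
have Dm1 m : lemx (D m) 1%:M.
  exact: (lemx_trans (lemx_term_sum m pD) D1).
pose err m := Rtr (tenspow W (u m) *m (1%:M - D m)).
have per m : ln c * (1 - 2 * (err m + c * Rtr (sig *m D m))) <= \sum_k h (tnth (u m) k) + 1.
  have uT : unitary (tp (fun k => Ux (tnth (u m) k))) by exact: tp_unitary.
  have aa0 (i : 'I_(n ^ l)) : 0 <= \prod_(k < l) a (tnth (u m) k) (digit i k) by apply: prodr_ge0.
  have aa1 : \sum_(i : 'I_(n ^ l)) \prod_(k < l) a (tnth (u m) k) (digit i k) = 1.
    rewrite (sum_digit (fun f : {ffun 'I_l -> 'I_n} => \prod_k a (tnth (u m) k) (f k))).
    by rewrite (sum_ffun_prod (fun k => a (tnth (u m) k))) big1.
  have := one_shot_converse uT uVV aa0 aa1 bb0 c1 (pD m) (Dm1 m).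
  rewrite -/sig -(tp_usp (fun k => Ux (tnth (u m) k)) (fun k => a (tnth (u m) k))) bb1.
  have -> : tp (fun k => usp (Ux (tnth (u m) k)) (a (tnth (u m) k))) = tenspow W (u m).
    by rewrite tenspowE; apply: eq_tp => k; rewrite -WE.
  rewrite -/(err m) => /le_trans; apply; rewrite lerD2r.
  rewrite (Hs_prod (fun k => a0 _) (fun k => a1 _)) tenspowE.
  have -> : usp (tp (fun _ : 'I_l => V)) (fun i => ln (\prod_k b (digit i k))) =
     usp (tp (fun _ : 'I_l => V)) (fun i => \sum_(k < l) ln (b (digit i k))).
    by apply: usp_eq => i; rewrite ln_prod.
  rewrite (Rtr_tp_sum (fun _ j => ln (b j)) (fun k => dW _) (fun k => uV)).
  by rewrite -sumrN -sumrB.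
have sigD : \sum_m Rtr (sig *m D m) <= 1.
  rewrite -Rtr_sum -mulmx_sumr; apply: (le_trans (Rtr_leM psig D1)).
  by rewrite mulmx1 /Rtr usp_tr // bb1.
have hsum : M%:R^-1 * \sum_m \sum_k h (tnth (u m) k) = l%:R * \sum_x p x * h x.
  by rewrite empirical_sum; field; rewrite !gt_eqF.
have hp : \sum_x p x * h x <= ln 2 * holevo p W + n%:R * eta.
  have -> : \sum_x p x * h x = - (\sum_x p x * Hs (a x)) - Rtr (usp V s *m usp V (fun j => ln (b j))).
    rewrite -sE mulmx_suml Rtr_sum -sumrN -sumrB; apply: eq_bigr => x _.
    by rewrite -scalemxAl RtrZ /h mulrBr mulrN.
  rewrite uspM // /Rtr usp_tr //= /holevo mulrBr sS mulr_sumr.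
  have -> : \sum_x ln 2 * (p x * vN_entropy (W x)) = \sum_x p x * Hs (a x).
    by apply: eq_bigr => x _; rewrite mulrCA aS.
  have := cross_entropy_smoothed s0 s1 e0; rewrite -/b; lra.
have lc : 0 <= ln c by exact: ln_ge0.
have avgE : avg_err W u D = M%:R^-1 * \sum_m err m by [].
have total : M%:R^-1 * \sum_m (ln c * (1 - 2 * (err m + c * Rtr (sig *m D m)))) <=
   M%:R^-1 * \sum_m (\sum_k h (tnth (u m) k) + 1).
  by apply: ler_wpM2l; [rewrite invr_ge0|apply: ler_sum => m _; exact: per].
have RE : M%:R^-1 * \sum_(m < M) (\sum_k h (tnth (u m) k) + 1) = l%:R * \sum_x p x * h x + 1.
  by rewrite big_split /= mulrDr hsum sumr_const card_ord mulVf // gt_eqF.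
have LE : M%:R^-1 * \sum_m (ln c * (1 - 2 * (err m + c * Rtr (sig *m D m)))) =
   ln c * (1 - 2 * (avg_err W u D + c * (M%:R^-1 * \sum_m Rtr (sig *m D m)))).
  rewrite -mulr_sumr mulrCA; congr (_ * _).
  rewrite sumrB -mulr_sumr big_split /= -mulr_sumr sumr_const card_ord avgE.
  by rewrite mulrBr mulVf ?gt_eqF //; ring.
rewrite RE LE in total.
apply: (@le_trans _ _ (ln c * (1 - 2 * (avg_err W u D + c * (M%:R^-1 * \sum_m Rtr (sig *m D m)))))).
  apply: ler_wpM2l => //; rewrite lerD2l lerN2; apply: (ler_wpM2l (ler0n R 2)).
  rewrite lerD2l; apply: ler_wpM2l; first by lra.
  by rewrite -[leRHS]mulr1 ler_wpM2l // invr_ge0.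
apply: (le_trans total); rewrite lerD2r; apply: ler_wpM2l => //.
Qed.

End BlockConverse.

Import numFieldNormedType.Exports.

(** * The maximizing input distribution *)

Section Maximizer.
Variable R : realType.
Local Notation C := R[i].
Local Notation adj := (@adjmx R _ _).
Local Notation "x %:C" := (real_complex R x) : ring_scope.

(** The output entropy is replaced by the cross entropy with the output of p0 shifted by eta. This
    is linear in q. Klein's inequality puts it above the entropy up to the excess trace n eta, and
    at p0 it is no larger than the entropy, since ln increases. *)
Lemma holevo_affine_bound (X : finType) n (p0 : X -> R) (W : X -> 'M[C]_n) (e : R) :
  is_distr p0 -> cq_channel W -> 0 < e ->
  exists phi : X -> R,
    (forall q, is_distr q -> holevo q W <= \sum_x q x * phi x + e) /\
    \sum_x p0 x * phi x <= holevo p0 W.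
Proof.
have arith (x y z w : R) : 1 - (1 + z) <= - x - y -> z <= w -> x <= - y + w.
  by move=> *; lra.
move=> dp dW e0; have l2 := ln2_gt0 R.
have [[V s] /= [uV sE s0 s1 sS]] := density_usp (mixture_density dp dW).
pose eta := e * ln 2 / (n%:R + 1).
have nR : 0 < n%:R + 1 :> R by rewrite ltr_wpDl.
have et0 : 0 < eta by rewrite divr_gt0 // mulr_gt0.
have ne : n%:R * eta <= e * ln 2.
  rewrite /eta mulrA ler_pdivrMr // mulrC; apply: ler_wpM2l; last by lra.
  by rewrite ltW // mulr_gt0.
pose b j := s j + eta.
have b0 j : 0 < b j by rewrite ltr_wpDl.
pose cross (A : 'M[C]_n) := - Rtr (A *m usp V (fun j => ln (b j))).
have cross_mix q : cross (\sum_x (q x)%:C *: W x) = \sum_x q x * cross (W x).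
  rewrite /cross mulmx_suml Rtr_sum -sumrN; apply: eq_bigr => x _.
  by rewrite -scalemxAl RtrZ mulrN.
exists (fun x => (ln 2)^-1 * cross (W x) - vN_entropy (W x)); split.
  move=> q dq; have [[U a] /= [uU aE a0 a1 aS]] := density_usp (mixture_density dq dW).
  have kl := klein uU uV a0 a1 b0; rewrite -aE -aS in kl.
  have bs : \sum_j b j = 1 + n%:R * eta.
    by rewrite big_split /= s1 sumr_const card_ord mulr_natl.
  rewrite bs in kl.
  have h : ln 2 * vN_entropy (\sum_x (q x)%:C *: W x) <= cross (\sum_x (q x)%:C *: W x) + e * ln 2.
    by rewrite /cross; exact: (arith _ _ _ _ kl ne).
  rewrite cross_mix in h.
  rewrite /holevo; under [X in _ <= X + _]eq_bigr do rewrite mulrBr mulrCA.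
  rewrite sumrB -mulr_sumr addrAC lerD2r.
  by rewrite -(ler_pM2l l2) mulrDr mulVKf ?gt_eqF // (mulrC _ e).
under eq_bigr do rewrite mulrBr mulrCA.
rewrite sumrB -mulr_sumr -cross_mix /holevo lerD2r -(ler_pM2l l2) mulVKf ?gt_eqF //.
rewrite sS /cross sE uspM // /Rtr usp_tr //= /Hs lerN2; apply: ler_sum => j _.
have := s0 j; rewrite le_eqVlt => /predU1P[<-|sj]; first by rewrite !mul0r.
by rewrite ler_pM2l // ler_ln ?posrE // lerDl ltW.
Qed.

Lemma linear_form_continuous k (phi : 'I_k -> R) (r : seq 'I_k) :
  continuous (fun v : 'rV[R]_k => \sum_(i <- r) v ord0 i * phi i).
Proof.
elim: r => [|i r IH].
  by under eq_fun do rewrite big_nil; exact: cst_continuous.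
under eq_fun do rewrite big_cons.
move=> v.
have h : continuous (fun v : 'rV[R]_k => v ord0 i) by exact: coord_continuous.
exact: (cvgD (cvgM (h v) (cvg_cst (phi i))) (IH v)).
Qed.

Lemma fset_max (T : choiceType) (g : T -> \bar R) (D : {fset T}) x0 : x0 \in D ->
  exists2 y, y \in D & forall z, z \in D -> (g z <= g y)%E.
Proof.
move=> x0D; have : forall s : seq T, s != [::] ->
    exists2 y, y \in s & forall z, z \in s -> (g z <= g y)%E.
  elim=> // a s IH _; have [->|/IH[y ys hy]] := eqVneq s [::].
    by exists a; [rewrite mem_head|move=> z; rewrite inE => /eqP ->].
  have [h|h] := leP (g a) (g y).
    by exists y; [rewrite inE ys orbT|move=> z; rewrite inE => /predU1P[->|/hy]].
  exists a; first by rewrite mem_head.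
  by move=> z; rewrite inE => /predU1P[->|/hy h2] //; apply: (le_trans h2); exact: ltW.
move=> /(_ (enum_fset D)); apply.
by apply: contraTneq x0D => h; rewrite -[x0 \in D]/(x0 \in enum_fset D) h.
Qed.

(* By [holevo_affine_bound] the sets {g < g q} are open on the simplex; if there were no
   maximizer, finitely many of them would cover it, also the best of the finitely many q. *)
Lemma inf_holevo_max (X : finType) n (Wset : set (X -> 'M[C]_n)) :
  (0 < #|X|)%N -> (forall W, Wset W -> cq_channel W) ->
  exists2 p : X -> R, is_distr p &
    forall q, is_distr q -> (inf_holevo Wset q <= inf_holevo Wset p)%E.
Proof.
move=> X0 hW; pose k := #|X|.
(* Distributions become row vectors, for which compactness of boxes is available. *)
pose dist (v : 'rV[R]_k) (x : X) := v ord0 (enum_rank x).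
have distK (q : X -> R) : dist (\row_i q (enum_val i)) = q.
  by apply/funext => x; rewrite /dist mxE enum_rankK.
pose g v := inf_holevo Wset (dist v).
pose Delta := [set v | is_distr (dist v)].
have sumE v (phi : X -> R) : \sum_x dist v x * phi x = \sum_i v ord0 i * phi (enum_val i).
  rewrite [RHS](reindex (@enum_rank X)) /=; last first.
    by apply: onW_bij; exact: enum_rank_bij.
  by apply: eq_bigr => x _; rewrite enum_rankK.
have lin_cont (phi : X -> R) : continuous (fun v : 'rV[R]_k => \sum_x dist v x * phi x).
  have -> : (fun v : 'rV[R]_k => \sum_x dist v x * phi x) =
      (fun v : 'rV[R]_k => \sum_i v ord0 i * phi (enum_val i)).
    by apply/funext => v; exact: sumE.
  exact: linear_form_continuous.
have cD : compact Delta.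
  apply: (@subclosed_compact _ _ [set v : 'rV[R]_k | forall i, `[0, 1]%classic (v ord0 i)]).
  - have -> : Delta = (fun v : 'rV[R]_k => \sum_x dist v x * 1) @^-1` [set y | y = 1] `&`
        \bigcap_(x in setT) (fun v : 'rV[R]_k => dist v x) @^-1` [set y | 0 <= y].
      apply/seteqP; split => v /=.
        by case=> h0 h1; split=> [|x _]; [under eq_bigr do rewrite mulr1|exact: h0].
      by case=> h1 h0; split=> [x|]; [exact: h0|move: h1; under eq_bigr do rewrite mulr1].
    apply: closedI.
      by move/continuous_closedP: (lin_cont (fun=> 1)); apply; exact: closed_eq.
    apply: closed_bigI => x _; have c : continuous (fun v : 'rV[R]_k => dist v x).
      by rewrite /dist; exact: coord_continuous.
    by move/continuous_closedP: c; apply; exact: closed_ge.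
  - exact: (@rV_compact R k (fun=> `[0, 1]%classic) (fun _ => @segment_compact R 0 1)).
  - move=> v [h0 h1] i; rewrite /= in_itv /=.
    have vE : v ord0 i = dist v (enum_val i) by rewrite /dist enum_valK.
    rewrite vE h0 /= -h1 (bigD1 (enum_val i)) //= lerDl.
    by apply: sumr_ge0 => x _; exact: h0.
apply: contrapT => nomax.
have better v : Delta v -> exists2 q, Delta q & (g v < g q)%E.
  move=> dv; apply: contrapT => h; apply: nomax; exists (dist v) => // q dq.
  rewrite leNgt; apply/negP => lt; apply: h; exists (\row_i q (enum_val i)).
    by rewrite /Delta /= distK.
  by rewrite /g distK.
(* A union of open half-spaces, one for each affine bound z.1.1 with slack z.1.2 of some channel and
   each level z.2 below g q. Membership certifies g v < g q. *)
pose F (q : 'rV[R]_k) := \bigcup_(z in [set z : (X -> R) * R * R |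
   (exists2 W, Wset W & forall q', is_distr q' -> holevo q' W <= \sum_x q' x * z.1.1 x + z.1.2) /\
   (z.2%:E < g q)%E]) [set v : 'rV[R]_k | \sum_x dist v x * z.1.1 x < z.2 - z.1.2].
have openF q : open (F q).
  apply: bigcup_open => z _.
  have /continuousP h := lin_cont z.1.1.
  exact: (h [set y | y < z.2 - z.1.2] (@open_lt R _)).
have cover : Delta `<=` cover Delta F.
  move=> v dv; have [q dq lt] := better v dv; exists q => //.
  have /ereal_inf_lt[_ [W hWW <-] ltW] := lt.
  have [t t1 t2] : exists2 t : R, holevo (dist v) W < t & (t%:E < g q)%E.
    move: ltW; case: (g q) => [y| |] //=; rewrite ?lte_fin => h.
      exists ((holevo (dist v) W + y) / 2); rewrite ?lte_fin; lra.
    by exists (holevo (dist v) W + 1); rewrite ?ltry //; lra.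
  have e0 : 0 < (t - holevo (dist v) W) / 2 by lra.
  have [phi [h1 h2]] := holevo_affine_bound dv (hW _ hWW) e0.
  (* Half of the gap as slack leaves the half-space inequality strict at v. *)
  exists (phi, (t - holevo (dist v) W) / 2, t) => /=; last by lra.
  by split=> //; exists W.
rewrite compact_cover in cD.
have [D' sub cov] := cD _ Delta F (fun q _ => openF q) cover.
have below v q : Delta v -> F q v -> (g v < g q)%E.
  move=> dv [[[phi e] t] /= [[W hWW hb] ht] hv].
  apply: le_lt_trans ht; apply: (@le_trans _ _ (holevo (dist v) W)%:E).
    by apply: ereal_inf_lbound; exists W.
  rewrite lee_fin; apply: (le_trans (hb _ dv)); lra.
have /card_gt0P[x1 _] := X0.
have d1 : Delta (\row_i (enum_val i == x1)%:R).
  rewrite /Delta /= (distK (fun x => (x == x1)%:R)); split=> [x|]; first exact: ler0n.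
  by rewrite (bigD1 x1) //= eqxx big1 ?addr0 // => x /negbTE ->.
have [q1 q1D _] := cov _ d1.
have [y yD hy] := fset_max g q1D.
have dy : Delta y := set_mem (sub _ yD).
have [z zD Fz] := cov _ dy.
by have := below _ _ dy Fz; rewrite ltNge hy.
Qed.

End Maximizer.

(** * The capacity formula *)

Section Limits.
Variable R : realType.
Implicit Types (u : (\bar R)^nat) (a : \bar R).

Lemma limn_esup_le u a N : (forall l, (N <= l)%N -> (u l <= a)%E) -> (limn_esup u <= a)%E.
Proof.
move=> h; apply: (@le_trans _ _ (ereal_sup (u @` [set l | (N <= l)%N]))).
  by apply: ereal_inf_lbound; exists [set l | (N <= l)%N] => //; exists N.
by apply: ge_ereal_sup => _ [l /= Nl <-]; exact: h.
Qed.

Lemma limn_esup_lt u a : (limn_esup u < a)%E ->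
  exists N, forall l, (N <= l)%N -> (u l < a)%E.
Proof.
move=> /ereal_inf_lt[_ [V [N _ NV] <-] h]; exists N => l Nl.
by apply: le_lt_trans h; apply: ereal_sup_ubound; exists l => //; exact: NV.
Qed.

Lemma limn_einf_ge u a N : (forall l, (N <= l)%N -> (a <= u l)%E) -> (a <= limn_einf u)%E.
Proof.
by move=> h; rewrite /limn_einf leeNr; apply: (@limn_esup_le _ _ N) => l Nl; rewrite leeN2 h.
Qed.

Lemma limn_einf_gt u a : (a < limn_einf u)%E ->
  exists N, forall l, (N <= l)%N -> (a < u l)%E.
Proof.
rewrite /limn_einf lteNr => /limn_esup_lt[N h]; exists N => l /h.
by rewrite lteN2.
Qed.

Lemma expR_decay (K g e : R) : 0 < g -> 0 < e ->
  exists N, forall l, (N <= l)%N -> K * expR (- (l%:R * g)) <= e.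
Proof.
move=> g0 e0; exists (Num.truncn (`|K| / e / g)).+1 => l hl.
apply: (@le_trans _ _ (`|K| * expR (- (l%:R * g)))).
  by apply: ler_wpM2r; [exact: expR_ge0|exact: ler_norm].
rewrite expRN ler_pdivrMr ?expR_gt0 //.
have h1 : `|K| / e / g <= l%:R.
  apply: ltW; apply: (lt_le_trans (truncnS_gt _)); by rewrite ler_nat.
have h2 := expR_ge1Dx (l%:R * g).
move: h1; rewrite ler_pdivrMr // ler_pdivrMr // => h1.
apply: (le_trans h1); rewrite mulrC; apply: ler_wpM2l; [exact: ltW|lra].
Qed.

Lemma inv_decay (e : R) : 0 < e -> exists N, forall l, (N <= l)%N -> 1 <= l%:R * e.
Proof.
move=> e0; exists (Num.truncn e^-1).+1 => l hl.
rewrite -ler_pdivrMr // mul1r; apply: ltW; apply: (lt_le_trans (truncnS_gt _)).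
by rewrite ler_nat.
Qed.

End Limits.

Section Capacity.
Variable R : realType.
Local Notation C := R[i].
Local Notation "x %:C" := (real_complex R x) : ring_scope.

Lemma rate_ge l (M : nat) (r : R) : (0 < l)%N -> expR (l%:R * (ln 2 * r)) <= M%:R ->
  r <= l%:R^-1 * log2 M%:R.
Proof.
move=> l0 h; have lR : 0 < l%:R :> R by rewrite ltr0n.
have l2 := ln2_gt0 R.
have M0 : 0 < M%:R :> R by apply: lt_le_trans h; exact: expR_gt0.
rewrite ler_pdivlMl // /log2 ler_pdivlMr //.
rewrite -ler_expR lnK ?posrE //; apply: le_trans h; rewrite ler_expR.
by rewrite le_eqVlt; apply/orP; left; apply/eqP; ring.
Qed.

Lemma achievable_below_holevo (X : finType) n (Wset : set (X -> 'M[C]_n)) p W0 (r : R) :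
  Wset W0 -> (forall W, Wset W -> cq_channel W) -> is_distr p -> 0 <= r ->
  (r%:E < inf_holevo Wset p)%E -> achievable Wset 0 r.
Proof.
move=> WW0 hW dp r0 hr.
have [t rt ht] : exists2 t : R, r < t & (t%:E <= inf_holevo Wset p)%E.
  move: hr; case: (inf_holevo Wset p) => [y| |] // h.
    by exists y.
  by exists (r + 1); [lra|rewrite leey].
have l2 := ln2_gt0 R.
(* The gap t - r pays for the 7 delta; 16 is the cap of the Chernoff exponent. *)
pose delta := Num.min 16 (ln 2 * (t - r) / 7).
have d0 : 0 < delta.
  by rewrite lt_min ltr0n /= divr_gt0 // mulr_gt0 // subr_gt0.
have d16 : delta <= 16 by rewrite ge_min lexx.
have dr : ln 2 * r + 7 * delta <= ln 2 * t.
  have : delta <= ln 2 * (t - r) / 7 by rewrite ge_min lexx orbT.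
  rewrite ler_pdivlMr ?ltr0n // mulrBr; lra.
have hh W : Wset W -> ln 2 * r + 7 * delta <= ln 2 * holevo p W.
  move=> hWW; apply: (le_trans dr); apply: ler_wpM2l; first exact: ltW.
  by rewrite -lee_fin; apply: (le_trans ht); apply: ereal_inf_lbound; exists W.
have [K [gam [g0 codes]]] := compound_codes WW0 hW dp r0 d0 d16 hh.
have [M [u [D P]]] : exists (M : nat -> nat) (u : forall l, 'I_(M l) -> l.-tuple X)
    (D : forall l, 'I_(M l) -> 'M[C]_(n ^ l)), forall l,
    [/\ (0 < M l)%N, is_code (u l) (D l), expR (l%:R * (ln 2 * r)) <= (M l)%:R &
      forall W, Wset W -> avg_err W (u l) (D l) <= K * expR (- (l%:R * gam))].
  exists (fun l => projT1 (cid (codes l))).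
  exists (fun l => projT1 (cid (projT2 (cid (codes l))))).
  exists (fun l => projT1 (cid (projT2 (cid (projT2 (cid (codes l))))))) => l.
  exact: (projT2 (cid (projT2 (cid (projT2 (cid (codes l))))))).
split; first exact: r0.
exists M, u, D; split; first by move=> l; case: (P l).
split; first by move=> l; case: (P l).
split.
  (* At l = 0 the inverse is 0 by convention, so the rate estimate starts at 1. *)
  apply: (@limn_einf_ge _ _ _ 1) => l l1; rewrite lee_fin; apply: rate_ge => //.
  by case: (P l).
apply/lee_addgt0Pr => e e0; rewrite add0e.
have [N hN] := expR_decay K g0 e0.
apply: (@limn_esup_le _ _ _ N) => l Nl; apply: ge_ereal_sup => _ [W hWW <-].
rewrite lee_fin; apply: le_trans (hN l Nl).
by case: (P l) => _ _ _; apply.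
Qed.

(** A single message needs no decoding. This makes the capacity nonnegative, so a real number above
    it is an admissible rate. *)
Lemma achievable0 (X : finType) n (Wset : set (X -> 'M[C]_n)) :
  (0 < #|X|)%N -> achievable Wset 0 0.
Proof.
move=> /card_gt0P[x _]; split=> //.
exists (fun=> 1%N), (fun l _ => [tuple x | k < l]), (fun l _ => 1%:M).
split=> //; split.
  move=> l; split; first by move=> m; exact: psdmx1.
  by rewrite /lemx big_ord1 subrr; exact: psdmx0.
split.
  by apply: (@limn_einf_ge _ _ _ 0) => l _; rewrite /log2 ln1 mul0r mulr0.
apply: (@limn_esup_le _ _ _ 0) => l _; apply: ge_ereal_sup => _ [W hWW <-].
by rewrite lee_fin /avg_err big_ord1 subrr mulmx0 mxtrace0 mulr0.
Qed.

(** With no channel the supremum of errors is taken over the empty set, so even the zero decoder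
    works; the infimum of the Holevo information is then infinite as well. *)
Lemma achievable_empty (X : finType) n (r : R) : (0 < #|X|)%N -> 0 <= r ->
  achievable (set0 : set (X -> 'M[C]_n)) 0 r.
Proof.
move=> /card_gt0P[x _] r0; split=> //.
exists (fun l => (Num.truncn (expR (l%:R * (ln 2 * r)))).+1), (fun l _ => [tuple x | k < l]), (fun l _ => 0).
split=> //; split.
  move=> l; split; first by move=> m; exact: psdmx0.
  by rewrite /lemx big1 // subr0; exact: psdmx1.
split.
  apply: (@limn_einf_ge _ _ _ 1) => l l1; rewrite lee_fin; apply: rate_ge => //.
  by apply: ltW; exact: truncnS_gt.
apply: (@limn_esup_le _ _ _ 0) => l _; apply: ge_ereal_sup => _ [W []].
Qed.

Lemma converse (X : finType) n (Wset : set (X -> 'M[C]_n)) (r a : R) :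
  (forall W, Wset W -> cq_channel W) -> achievable Wset 0 r ->
  (forall q, is_distr q -> exists2 W, Wset W & holevo q W < a) -> r <= a.
Proof.
move=> hW [r0 [M [u [D [M0 [codes [rate error]]]]]]] low.
have l2 := ln2_gt0 R.
have nR : 0 < n%:R + 1 :> R by rewrite ltr_wpDl.
have etaP (g : R) : 0 < g -> exists2 eta : R, 0 < eta & n%:R * eta <= g.
  move=> g0; exists (g / (n%:R + 1)); first exact: divr_gt0.
  rewrite mulrA ler_pdivrMr // mulrC; apply: ler_wpM2l; [exact: ltW|lra].
(* A negative a is refuted by [code_bound] with c = 1: its left side is 0, while its right side
   becomes negative for large l. *)
have [a0|a0] := ltP a 0.
  have g0 : 0 < - (ln 2 * a) / 4 by rewrite divr_gt0 // -mulrN mulr_gt0 // oppr_gt0.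
  have [eta e0 he] := etaP _ g0.
  have [N hN] := inv_decay g0.
  pose l := N.+1; have lR : 0 < l%:R :> R by rewrite ltr0n.
  have [W hWW hlow] := low _ (empirical_distr R (u l) (ltn0Sn N) (M0 l)).
  have := code_bound (ltn0Sn N) (M0 l) (codes l) (hW _ hWW) (lexx 1) e0.
  rewrite ln1 mul0r -/l => h.
  have h1 : l%:R * (ln 2 * holevo (empirical R (u l)) W + n%:R * eta) <=
      l%:R * (ln 2 * a + - (ln 2 * a) / 4).
    apply: ler_wpM2l; first exact: ltW.
    by apply: lerD => //; apply: ler_wpM2l; exact: ltW.
  have h2 := hN l (leqnSn N).
  lra.
rewrite leNgt; apply/negP => ar.
(* The threshold c has rate a1 = a + d and the code eventually exceeds the rate a2 = a1 + d, so c /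
   M decays exponentially. *)
pose d := (r - a) / 4; have d0 : 0 < d by rewrite /d; lra.
pose a1 := a + d; pose a2 := a + 2 * d.
have a10 : 0 < a1 by rewrite /a1; lra.
(* Error and c / M together cost a1 (4 e) = d / 4 in rate. The left side keeps a + 3 d / 4, whereas
   smoothing and the final 1 raise the right side to at most a + d / 2. *)
pose e := d / (16 * a1).
have e0 : 0 < e by rewrite divr_gt0 // mulr_gt0.
have ed : 16 * (a1 * e) = d by rewrite /e; field; rewrite gt_eqF.
have l2d : 0 < ln 2 * d by apply: mulr_gt0.
have g0 : 0 < ln 2 * d / 4 by apply: divr_gt0.
have [eta eta0 he] := etaP _ g0.
have [N1 hN1] := inv_decay g0.
have [N2 hN2] := expR_decay 1 l2d e0.
have [N3 hN3] : exists N, forall l, (N <= l)%N -> (a2%:E < ((l%:R)^-1 * log2 (M l)%:R)%:E)%E.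
  by apply: limn_einf_gt; apply: lt_le_trans rate; rewrite lte_fin /a2 /d; lra.
have error_lt := le_lt_trans error (etrans (lte_fin 0 e) e0).
have [N4 hN4] := limn_esup_lt error_lt.
pose l := (maxn (maxn N1 N2) (maxn N3 N4)).+1.
have L1 : (N1 <= l)%N by rewrite /l leqW // !leq_max leqnn.
have L2 : (N2 <= l)%N by rewrite /l leqW // !leq_max leqnn !orbT.
have L3 : (N3 <= l)%N by rewrite /l leqW // !leq_max leqnn !orbT.
have L4 : (N4 <= l)%N by rewrite /l leqW // !leq_max leqnn !orbT.
have l0 : (0 < l)%N by [].
clearbody l.
have lR : 0 < l%:R :> R by rewrite ltr0n.
have [W hWW hlow] := low _ (empirical_distr R (u l) l0 (M0 l)).
have MR : 0 < (M l)%:R :> R by rewrite ltr0n.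
have err : avg_err W (u l) (D l) <= e.
  rewrite -lee_fin; apply: le_trans (ltW (hN4 l L4)).
  by apply: ereal_sup_ubound; exists W.
pose c := expR (l%:R * (ln 2 * a1)).
have c1 : 1 <= c by rewrite -[leLHS]expR0 ler_expR !mulr_ge0 // ltW.
have Mge : expR (l%:R * (ln 2 * a2)) <= (M l)%:R.
  have := hN3 l L3; rewrite lte_fin ltr_pdivlMl // /log2 ltr_pdivlMr // => h.
  rewrite -[leRHS]lnK ?posrE // ler_expR; apply: le_trans (ltW h).
  by rewrite le_eqVlt; apply/orP; left; apply/eqP; ring.
have cM : c / (M l)%:R <= e.
  apply: le_trans (hN2 l L2); rewrite mul1r ler_pdivrMr //.
  apply: (@le_trans _ _ (expR (- (l%:R * (ln 2 * d))) * expR (l%:R * (ln 2 * a2)))).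
    rewrite -expRD ler_expR le_eqVlt; apply/orP; left; apply/eqP; rewrite /a1 /a2; ring.
  by apply: ler_wpM2l => //; exact: expR_ge0.
have main := code_bound l0 (M0 l) (codes l) (hW _ hWW) c1 eta0.
rewrite {1}/c expRK in main.
have hup : l%:R * (ln 2 * holevo (empirical R (u l)) W + n%:R * eta) <=
    l%:R * (ln 2 * a + ln 2 * d / 4).
  apply: ler_wpM2l; first exact: ltW.
  by apply: lerD => //; apply: ler_wpM2l; exact: ltW.
have hlo : l%:R * (ln 2 * a1) * (1 - 2 * (e + e)) <=
    l%:R * (ln 2 * a1) * (1 - 2 * (avg_err W (u l) (D l) + c / (M l)%:R)).
  apply: ler_wpM2l; first by rewrite !mulr_ge0 // ltW.
  by rewrite lerD2l lerN2; apply: (ler_wpM2l (ler0n R 2)); exact: lerD.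
have loE : l%:R * (ln 2 * a1) * (1 - 2 * (e + e)) =
    l%:R * (ln 2 * a) + l%:R * (ln 2 * d) - l%:R * (ln 2 * d) / 4.
  have -> : l%:R * (ln 2 * a1) * (1 - 2 * (e + e)) =
    l%:R * (ln 2 * a1) - l%:R * ln 2 * (16 * (a1 * e)) / 4 by field.
  by rewrite ed /a1; field.
have h1 := hN1 l L1.
have pos : 0 < l%:R * (ln 2 * d) by apply: mulr_gt0.
lra.
Qed.

End Capacity.

Theorem theorem1 (R : realType) (X : finType) (n : nat)
    (Wset : set (X -> 'M[R[i]]_n)) :
  (0 < #|X|)%N ->
  (forall W, Wset W -> cq_channel W) ->
  exists2 p : X -> R, is_distr p &
    (forall q : X -> R, is_distr q -> (inf_holevo Wset q <= inf_holevo Wset p)%E) /\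
    cap_avg Wset 0 = inf_holevo Wset p.
Proof.
move=> X0 hW; have [p dp hp] := inf_holevo_max X0 hW.
exists p => //; split=> //.
have [[W0 WW0]|empty] := pselect (exists W, Wset W); last first.
  have -> : Wset = set0 by apply/seteqP; split=> // W hWW; apply: empty; exists W.
  rewrite /inf_holevo image_set0 ereal_inf0.
  apply/eqyP => y y0; apply: (@le_trans _ _ (Num.max y 0)%:E).
    by rewrite lee_fin le_max lexx.
  apply: ereal_sup_ubound; exists (Num.max y 0) => //=.
  by apply: achievable_empty; rewrite // le_max lexx orbT.
apply/eqP; rewrite eq_le; apply/andP; split.
  apply: ge_ereal_sup => _ [r ar <-]; rewrite leNgt; apply/negP => lt.
  have [a [ia ltar]] : exists a : R, (inf_holevo Wset p < a%:E)%E /\ a < r.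
    move: lt; case: (inf_holevo Wset p) => [y| |] //=; rewrite ?lte_fin => h.
      by exists ((y + r) / 2); rewrite lte_fin; split; lra.
    by exists (r - 1); rewrite ltNyr; split=> //; lra.
  (* Because p is a maximizer, the same a exceeds the infimum at every q, whatever the empirical
     distribution of the code turns out to be. *)
  have low q : is_distr q -> exists2 W, Wset W & holevo q W < a.
    move=> dq; have /ereal_inf_lt[_ [W hWW <-]] := le_lt_trans (hp q dq) ia.
    by rewrite lte_fin; exists W.
  by have := converse hW ar low; rewrite leNgt ltar.
rewrite leNgt; apply/negP => lt.
have cap0 : (0%:E <= cap_avg Wset 0)%E.
  by apply: ereal_sup_ubound; exists 0 => //; exact: achievable0.
have [r [r1 r2]] : exists r : R, (cap_avg Wset 0 < r%:E)%E /\ (r%:E < inf_holevo Wset p)%E.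
  move: lt cap0; case: (cap_avg Wset 0) => [y| |]; last 2 first.
  - by rewrite ltNge leey.
  - by move=> _; rewrite leNgt ltNyr.
  move=> h _; move: h; case: (inf_holevo Wset p) => [z| |] //=; rewrite ?lte_fin => h.
    by exists ((y + z) / 2); rewrite !lte_fin; split; lra.
  by exists (y + 1); rewrite lte_fin ltry; split=> //; lra.
have r0 : 0 <= r by rewrite -lee_fin; apply: (le_trans cap0); exact: ltW.
have ach := achievable_below_holevo WW0 hW dp r0 r2.
by have := ereal_sup_ubound (imageP EFin ach); rewrite leNgt r1.
Qed.
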